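(* Let $\gamma\ge1$, $\mu,k>0$, $s\in\mathbb{R}$, and let $(R,U)$ be a traveling wave profile with speed $s$. Suppose $\mu^2>2k^2$. Let $\epsilon_\pm=\epsilon_\pm(\lambda)$ be the explicit quantities defined in the context. Then there is a constant $C>0$ such that $$\sqrt2\,\sqrt{\epsilon_+^2+\epsilon_-^2}<1\quad\text{for all }\lambda\in\mathbb{C}\text{ with }\Re(\lambda)\ge0\text{ and }|\lambda|\ge C.$$ As a consequence of this inequality, the Evans function $E(\lambda)$ for the scalar equation $$\hat\rho^{(4)}+2\Bigl(\frac{s\mu}{k^2}-\frac{R'}{R}\Bigr)\hat\rho'''+\frac{2}{k^2}\bigl(R(f_1+f_4+2\mu f_6'+g_4)+(s-U)(f_2+g_2)-\lambda\mu\bigr)\hat\rho''$$ $$+\frac{2}{k^2}\Bigl(R(f_1'+f_3+(f_2+g_2)f_6'+\mu f_6''+g_3)+(s-U)(f_2'+g_1)+\lambda\bigl(2(U-s)+\mu\tfrac{R'}{R}\bigr)\Bigr)\hat\rho'$$ $$+\frac{2}{k^2}\Bigl(\lambda\bigl(-f_2'-g_1+(f_2+g_2)\tfrac{R'}{R}-\mu R(R^{-1})''\bigr)+\lambda^2\Bigr)\hat\rho=0\qquad(\mathrm E)$$ has no zeros in the region $\{\Re(\lambda)\ge0,\ |\lambda|\ge C\}$.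
   Context: Enthalpy: $h(\rho)=\ln\rho$ if $\gamma=1$, $h(\rho)=\frac{\gamma}{\gamma-1}\rho^{\gamma-1}$ if $\gamma>1$. Profile: a traveling wave profile with speed $s$ is a pair of smooth functions $R>0$, $U$ on $\mathbb{R}$ with limits $R(x)\to R^\pm>0$, $U(x)\to U^\pm$ as $x\to\pm\infty$, all of whose derivatives tend to $0$ at $\pm\infty$, satisfying $-sR'+(RU)'=0$ and $-sU'+\bigl(\tfrac{U^2}{2}\bigr)'+(h(R))'=\mu\bigl(\tfrac{(RU)'}{R}\bigr)'+k^2\bigl(\tfrac{(\sqrt R)''}{\sqrt R}\bigr)'$. Functions of $x$ associated with the profile ($'=d/dx$): $f_1=-h'(R)$ (the derivative $\frac{dh}{dR}$ evaluated at $R(x)$; $f_1'$ is the $x$-derivative), $f_2=s-U$, $f_3=\frac{k^2}{2}\bigl((R^{-1/2}(R^{-1/2})'')'-(R^{-3/2}(R^{1/2})'')'\bigr)$, $f_4=\frac{k^2}{2}\bigl(R^{-1/2}(R^{-1/2})''+2(R^{-1/2}(R^{-1/2})')'-R^{-3/2}(R^{1/2})''\bigr)$, $f_6=\frac{s-U}{R}$, $g_1=\mu\bigl(\frac{R'}{R}\bigr)'$, $g_2=\mu\frac{R'}{R}$, $g_3=\mu\Bigl(\bigl(\frac{U'}{R}\bigr)'-\bigl(\frac{(RU)'}{R^2}\bigr)'\Bigr)$, $g_4=\mu\Bigl(\frac{U'}{R}+\bigl(\frac{U}{R}\bigr)'-\frac{(RU)'}{R^2}\Bigr)$. Definition of $\epsilon_\pm$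 (for $\mu^2>2k^2$). Let $w_\pm=\frac{\mu}{k^2}\pm\frac1k\sqrt{\frac{\mu^2}{k^2}-2}$ (so $w_+>w_->0$) and, for $\lambda\neq0$, $m_1(\lambda)=\frac{2}{k^2}|\lambda|^{-1}\sup_{x\ge0}\bigl|-f_2'-g_1+(f_2+g_2)\frac{R'}{R}-\mu R(R^{-1})''\bigr|$, $m_2(\lambda)=\frac{2}{k^2}\Bigl(|\lambda|^{-3/2}\sup_{x\ge0}\bigl|R(f_1'+f_3+(f_2+g_2)f_6'+\mu f_6''+g_3)+(s-U)(f_2'+g_1)\bigr|+|\lambda|^{-1/2}\sup_{x\ge0}\bigl|2(U-s)+\mu\frac{R'}{R}\bigr|\Bigr)$, $m_3(\lambda)=\frac{2}{k^2}|\lambda|^{-1}\sup_{x\ge0}\bigl|R(f_1+f_4+2\mu f_6'+g_4)+(s-U)(f_2+g_2)\bigr|$, $m_4(\lambda)=2|\lambda|^{-1/2}\sup_{x\ge0}\bigl|\frac{s\mu}{k^2}-\frac{R'}{R}\bigr|$. Set $p_1=p_3=\sum_{l=1}^4m_l(\lambda)\,w_+^{(l-1)/2}$, $p_2=p_4=\sum_{l=1}^4m_l(\lambda)\,w_-^{(l-1)/2}$, $q_1=q_3=2\sqrt{w_+}(w_+-w_-)$, $q_2=q_4=2\sqrt{w_-}(w_+-w_-)$, and let $\tilde B_+$ be the $4\times4$ matrix with entries $\tilde b_{j,k}=p_k/q_j$. The matrix $\tilde B_-$ is defined in the same way with the suprema in the $m_l(\lambda)$ taken over $x\le0$. Finally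 $\alpha=\sqrt{w_-/2}$ and $\epsilon_\pm=4\alpha^{-1}\|\tilde B_\pm\|_F$, where $\|A\|_F=\sqrt{\sum_{j,k}|a_{j,k}|^2}$. Evans function: write $(\mathrm E)$ as a first-order system $Y'=\tilde A(x,\lambda)Y$ for $Y=(\hat\rho,\hat\rho',\hat\rho'',\hat\rho''')^T$. For $\lambda$ such that each of the limit matrices at $x=\pm\infty$ has two eigenvalues with positive and two with negative real part, let $Y_1^-,Y_2^-$ be a basis of the solutions decaying as $x\to-\infty$ and $Y_1^+,Y_2^+$ a basis of the solutions decaying as $x\to+\infty$. The Evans function is $E(\lambda)=\det(Y_1^-(0),Y_2^-(0),Y_1^+(0),Y_2^+(0))$; whether it vanishes does not depend on the choice of bases. The assertion that $E$ has no zeros in a region includes that $E$ is defined there. *)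

(* Defs.v *)
From HB Require Import structures.
From mathcomp Require Import all_boot all_order all_algebra.
From mathcomp Require Import complex.
From mathcomp Require Import all_classical all_reals all_analysis.
Import Order.TTheory GRing.Theory Num.Theory numFieldNormedType.Exports.

Set Implicit Arguments.
Unset Strict Implicit.
Unset Printing Implicit Defensive.

Local Open Scope ring_scope.
Local Open Scope complex_scope.
Local Open Scope classical_set_scope.

(* In ring_scope these notations denote derivatives of polynomials. *)
Local Notation "f ^` ()" := (derive1 f) : ring_scope.
Local Notation "f ^` ( n )" := (derive1n n f) : ring_scope.

Section Profile.
Variable F : realType.
Implicit Types (gamma mu k s : F) (R U f : F -> F).

Definition smooth f := forall (n : nat) (x : F), derivable f^`(n) x 1.

Definition enthalpy gamma (rho : F) : F :=
  if gamma == 1 then ln rho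
  else gamma / (gamma - 1) * rho `^ (gamma - 1).

Definition sqrt_fun R : F -> F := fun x => Num.sqrt (R x).

Record is_profile gamma mu k s R U : Prop := IsProfile {
  profile_smoothR : smooth R;
  profile_smoothU : smooth U;
  profile_gt0 : forall x, 0 < R x;
  profile_cvgR : exists Rm Rp : F, [/\ 0 < Rm, 0 < Rp,
    R x @[x --> -oo] --> Rm & R x @[x --> +oo] --> Rp];
  profile_cvgU : exists Um Up : F,
    U x @[x --> -oo] --> Um /\ U x @[x --> +oo] --> Up;
  profile_derivR : forall n : nat, (0 < n)%N ->
    R^`(n) x @[x --> -oo] --> (0 : F) /\ R^`(n) x @[x --> +oo] --> (0 : F);
  profile_derivU : forall n : nat, (0 < n)%N ->
    U^`(n) x @[x --> -oo] --> (0 : F) /\ U^`(n) x @[x --> +oo] --> (0 : F);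
  profile_mass : forall x, - s * R^`() x + (R \* U)^`() x = 0;
  profile_momentum : forall x,
    - s * U^`() x + (fun y => U y ^+ 2 / 2)^`() x
      + (fun y => enthalpy gamma (R y))^`() x
    = mu * (fun y => (R \* U)^`() y / R y)^`() x
      + k ^+ 2 * (fun y => (sqrt_fun R)^`(2) y / sqrt_fun R y)^`() x
}.

End Profile.

Section Coefficients.
Variables (F : realType) (gamma mu k s : F) (R U : F -> F).

Definition Rpow (a : F) : F -> F := fun x => R x `^ a.
Definition Rinv : F -> F := fun x => (R x)^-1.

Definition f1 (x : F) : F := - (enthalpy gamma)^`() (R x).
Definition f2 (x : F) : F := s - U x.
Definition f3 (x : F) : F := k ^+ 2 / 2 *
  ((Rpow (- (1 / 2)) \* (Rpow (- (1 / 2)))^`(2))^`() x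
   - (Rpow (- (3 / 2)) \* (Rpow (1 / 2))^`(2))^`() x).
Definition f4 (x : F) : F := k ^+ 2 / 2 *
  (Rpow (- (1 / 2)) x * (Rpow (- (1 / 2)))^`(2) x
   + 2 * (Rpow (- (1 / 2)) \* (Rpow (- (1 / 2)))^`())^`() x
   - Rpow (- (3 / 2)) x * (Rpow (1 / 2))^`(2) x).
Definition f6 (x : F) : F := (s - U x) / R x.

Definition g1 (x : F) : F := mu * (fun y => R^`() y / R y)^`() x.
Definition g2 (x : F) : F := mu * (R^`() x / R x).
Definition g3 (x : F) : F := mu *
  ((fun y => U^`() y / R y)^`() x
   - (fun y => (R \* U)^`() y / R y ^+ 2)^`() x).
Definition g4 (x : F) : F := mu *
  (U^`() x / R x + (fun y => U y / R y)^`() x - (R \* U)^`() x / R x ^+ 2).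

(* The real functions of x from which both the coefficients of (E) and the
   quantities m_l are built. *)
Definition E_rho (x : F) : F :=
  - f2^`() x - g1 x + (f2 x + g2 x) * (R^`() x / R x) - mu * R x * Rinv^`(2) x.
Definition E_drho (x : F) : F :=
  R x * (f1^`() x + f3 x + (f2 x + g2 x) * f6^`() x + mu * f6^`(2) x + g3 x)
  + (s - U x) * (f2^`() x + g1 x).
Definition E_drho_lambda (x : F) : F :=
  2 * (U x - s) + mu * (R^`() x / R x).
Definition E_d2rho (x : F) : F :=
  R x * (f1 x + f4 x + 2 * mu * f6^`() x + g4 x) + (s - U x) * (f2 x + g2 x).
Definition E_d3rho (x : F) : F := s * mu / k ^+ 2 - R^`() x / R x.

Definition cabs (lambda : F[i]) : F := ComplexField.Normc.normc lambda.

(* In the next definitions D is the half-line over which the suprema are taken;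
   [m_] numbers m1, ..., m4 from 0, as ordinals do. *)
Definition supabs (D : set F) (f : F -> F) : F := sup [set `|f x| | x in D].

Definition m1 (D : set F) (lambda : F[i]) : F :=
  2 / k ^+ 2 * (cabs lambda `^ (- 1) * supabs D E_rho).
Definition m2 (D : set F) (lambda : F[i]) : F :=
  2 / k ^+ 2 * (cabs lambda `^ (- (3 / 2)) * supabs D E_drho
                + cabs lambda `^ (- (1 / 2)) * supabs D E_drho_lambda).
Definition m3 (D : set F) (lambda : F[i]) : F :=
  2 / k ^+ 2 * (cabs lambda `^ (- 1) * supabs D E_d2rho).
Definition m4 (D : set F) (lambda : F[i]) : F :=
  2 * (cabs lambda `^ (- (1 / 2)) * supabs D E_d3rho).

Definition m_ (D : set F) (lambda : F[i]) (l : 'I_4) : F :=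
  [:: m1 D lambda; m2 D lambda; m3 D lambda; m4 D lambda]`_l.

Definition w_plus : F :=
  mu / k ^+ 2 + 1 / k * Num.sqrt (mu ^+ 2 / k ^+ 2 - 2).
Definition w_minus : F :=
  mu / k ^+ 2 - 1 / k * Num.sqrt (mu ^+ 2 / k ^+ 2 - 2).

(* w_+ for the (1-based) indices 1 and 3, w_- for 2 and 4 *)
Definition w_ (j : 'I_4) : F := if odd j then w_minus else w_plus.

Definition p_ (D : set F) (lambda : F[i]) (j : 'I_4) : F :=
  \sum_(l < 4) m_ D lambda l * w_ j `^ (l%:R / 2).
Definition q_ (j : 'I_4) : F := 2 * Num.sqrt (w_ j) * (w_plus - w_minus).

Definition Btilde (D : set F) (lambda : F[i]) : 'M[F]_(4, 4) :=
  \matrix_(j < 4, l < 4) (p_ D lambda l / q_ j).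

Definition frobenius m n (A : 'M[F]_(m, n)) : F :=
  Num.sqrt (\sum_j \sum_l `|A j l| ^+ 2).

Definition alpha : F := Num.sqrt (w_minus / 2).

Definition epsilon (D : set F) (lambda : F[i]) : F :=
  4 * alpha^-1 * frobenius (Btilde D lambda).
Definition epsilon_plus := epsilon [set x | 0 <= x].
Definition epsilon_minus := epsilon [set x | x <= 0].

(* (E) reads rho'''' + c3 rho''' + c2 rho'' + c1 rho' + c0 rho = 0. *)
Definition E_c0 (lambda : F[i]) (x : F) : F[i] :=
  (2 / k ^+ 2)%:C * (lambda * (E_rho x)%:C + lambda ^+ 2).
Definition E_c1 (lambda : F[i]) (x : F) : F[i] :=
  (2 / k ^+ 2)%:C * ((E_drho x)%:C + lambda * (E_drho_lambda x)%:C).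
Definition E_c2 (lambda : F[i]) (x : F) : F[i] :=
  (2 / k ^+ 2)%:C * ((E_d2rho x)%:C - lambda * mu%:C).
Definition E_c3 (x : F) : F[i] := (2 * E_d3rho x)%:C.

(* [companionmx] has 1 on the superdiagonal and last row
   (- c0, - c1, - c2, - c3): Y' = Atilde Y is (E) for
   Y = (rho, rho', rho'', rho''')^T. *)
Definition Atilde (lambda : F[i]) (x : F) : 'M[F[i]]_(4, 4) :=
  companionmx [:: E_c0 lambda x; E_c1 lambda x; E_c2 lambda x; E_c3 x; 1].

End Coefficients.

(* F[i] carries no topology in the library; limits and derivatives of complex
   matrices depending on a real variable are taken entrywise, on real and
   imaginary parts. *)
Section Evans.
Variable F : realType.

Definition mxcvg m n (G : set_system F) (A : F -> 'M[F[i]]_(m, n))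
    (L : 'M[F[i]]_(m, n)) : Prop :=
  forall i j, complex.Re (A x i j) @[x --> G] --> complex.Re (L i j) /\
              complex.Im (A x i j) @[x --> G] --> complex.Im (L i j).

Definition mx_is_derive m n (x : F) (A : F -> 'M[F[i]]_(m, n))
    (dA : 'M[F[i]]_(m, n)) : Prop :=
  forall i j,
    is_derive x (1 : F) (fun y => complex.Re (A y i j)) (complex.Re (dA i j)) /\
    is_derive x (1 : F) (fun y => complex.Im (A y i j)) (complex.Im (dA i j)).

Variable A : F -> 'M[F[i]]_(4, 4).

(* Eigenvalues are counted with algebraic multiplicity. *)
Definition two_two_split (L : 'M[F[i]]_(4, 4)) : Prop :=
  exists rs : seq F[i],
    [/\ char_poly L = (\prod_(z <- rs) ('X - z%:P))%R,
        count (fun z => 0 < complex.Re z) rs = 2%N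
      & count (fun z => complex.Re z < 0) rs = 2%N].

Definition split_at (G : set_system F) : Prop :=
  exists2 L, mxcvg G A L & two_two_split L.

Definition ode_solution (Y : F -> 'cV[F[i]]_4) : Prop :=
  forall x, mx_is_derive x Y (A x *m Y x).

Definition decaying_solution (G : set_system F) (Y : F -> 'cV[F[i]]_4) : Prop :=
  ode_solution Y /\ mxcvg G Y 0.

Definition decaying_basis (G : set_system F) (Y1 Y2 : F -> 'cV[F[i]]_4) : Prop :=
  [/\ decaying_solution G Y1, decaying_solution G Y2,
      forall c1 c2 : F[i], (forall x, c1 *: Y1 x + c2 *: Y2 x = 0) ->
        c1 = 0 /\ c2 = 0
    & forall Y, decaying_solution G Y ->
        exists c1 c2 : F[i], forall x, Y x = c1 *: Y1 x + c2 *: Y2 x].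

(* The Evans function at a given parameter is determined only up to the choice
   of bases, hence is rendered as a relation: e is one of its values. *)
Definition evans_value (e : F[i]) : Prop :=
  exists Ym1 Ym2 Yp1 Yp2 : F -> 'cV[F[i]]_4,
    [/\ decaying_basis -oo Ym1 Ym2, decaying_basis +oo Yp1 Yp2
      & e = \det (row_mx (row_mx (Ym1 0) (Ym2 0)) (row_mx (Yp1 0) (Yp2 0)))].

Definition evans_defined : Prop :=
  [/\ split_at -oo, split_at +oo & exists e, evans_value e].

Definition evans_nonzero : Prop :=
  evans_defined /\ forall e, evans_value e -> e <> 0.

End Evans.

(* Main.v *)
Require Import Defs.
From HB Require Import structures.
From mathcomp Require Import all_boot all_order all_algebra.
From mathcomp Require Import complex.
From mathcomp Require Import all_classical all_reals all_analysis.
From mathcomp Require Import ring lra.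
Import Order.TTheory GRing.Theory Num.Theory numFieldNormedType.Exports.

(** The inequality is a matter of scaling. R, U and every function built from
    them are smooth with limits at both ends, hence bounded; so each m_l is
    O(|lambda|^(-1/2)), and epsilon as well ([epsilon_sqr_le]).

    For the Evans function, let r be the square root of lambda with positive
    real part; Re lambda >= 0 keeps Re r comparable to |r|. Put a^2 = w_+ and
    b^2 = w_-. Once the l-th derivative of rho is divided by r^l, equation (E)
    is a perturbation of the constant coefficient equation with symbol
    (X^2 - a^2)(X^2 - b^2), whose roots a, -a, b, -b are real, nonzero and
    distinct because mu^2 > 2 k^2. In the coordinates z_eta given by its left
    eigenvectors, (E) reads z_eta' = r eta z_eta - pi, where pi is the same for
    the four roots eta and is bounded by K |z| with K independent of x and
    lambda ([companion_modes], [coupling_bound]). The modes eta > 0 are called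
    unstable, the modes eta < 0 stable. When b Re r is large compared with K,
    each quadratic form al |z_unstable|^2 - be |z_stable|^2 with al, be in
    [1, 2] grows along solutions at least at the rate |z|^2
    ([mode_dichotomy]).

    This monotonicity yields both the existence of the decaying bases and the
    nonvanishing of the determinant. A solution that decays at +oo has all its
    energies <= 0, one that decays at -oo has all of them >= 0. If two such
    solutions agree at 0, their common value satisfies
    2 |z_unstable|^2 <= |z_stable|^2 and 2 |z_stable|^2 <= |z_unstable|^2, so it
    is 0 ([decaying_both_eq0]); hence the four columns of the Evans
    determinant are independent ([evans_nonzero_of_split]). Solutions that
    decay at +oo with a prescribed stable part at 0 are limits of the solutions
    with that stable part at 0 and no unstable part at n
    ([decaying_solution_exists]); the stable part at 0 determines the
    solution, so they form a space of complex dimension 2.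

    The limit matrices have two eigenvalues on either side of the imaginary
    axis because the product of the distances from r eta to the eigenvalues is
    the value of the characteristic polynomial at r eta, which is only
    O(|r|^3): some eigenvalue lies within a small multiple of |r| from each of
    the four points r eta ([quartic_two_two_split]). *)

Set Implicit Arguments.
Unset Strict Implicit.
Unset Printing Implicit Defensive.
Local Open Scope ring_scope.
Local Open Scope classical_set_scope.

(** * Calculus of real functions *)

Section Calculus.
Variable F : realType.
Implicit Types (f g : F -> F).

Lemma is_derive_continuous f (x df : F) : is_derive x (1 : F) f df -> {for x, continuous f}.
Proof. by case=> d _; apply/differentiable_continuous/derivable1_diffP. Qed.

Lemma le_of_derive_ge0 f (df : F -> F) (a b : F) : a <= b ->
  (forall z, a <= z <= b -> is_derive z (1 : F) f (df z)) ->
  (forall z, a <= z <= b -> 0 <= df z) -> f a <= f b.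
Proof.
move=> ab dfE df0.
have [||c] := @MVT_segment F f df a b ab.
- by move=> x; rewrite in_itv /= => /andP[ax xb]; apply: dfE; rewrite !ltW.
- apply: continuous_in_subspaceT => x; rewrite inE /= in_itv /= => xab.
  exact: is_derive_continuous (dfE x xab).
- rewrite in_itv /= => cab e; rewrite -subr_ge0 e mulr_ge0 ?subr_ge0//.
  exact: df0.
Qed.

Lemma eq_of_derive0 f (a b : F) : a <= b ->
  (forall z, a <= z <= b -> is_derive z (1 : F) f 0) -> f a = f b.
Proof.
move=> ab d0; apply/eqP; rewrite eq_le; apply/andP; split.
  exact: (le_of_derive_ge0 (df := cst 0)).
rewrite -lerN2.
apply: (le_of_derive_ge0 (f := fun x => - f x) (df := cst 0)) => // z zab.
have := d0 _ zab => dz.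
by rewrite /cst -oppr0; exact: is_deriveN.
Qed.

(** Integrating from -N gives a primitive on ]-N, +oo[; the primitives that
    vanish at 0 agree wherever two of them are defined, so the one with N =
    |x| + 1 can be used at x. *)
Lemma antiderivative f : continuous f ->
  exists g, g 0 = 0 /\ forall x : F, is_derive x (1 : F) g (f x).
Proof.
move=> cf.
pose G N x : F := (\int[lebesgue_measure]_(t in [set` `[- N, x]]) f t)%R
   - (\int[lebesgue_measure]_(t in [set` `[- N, (0:F)]]) f t)%R.
have intf (a b : F) : lebesgue_measure.-integrable `[a, b] (EFin \o f).
  apply: continuous_compact_integrable; first exact: segment_compact.
  exact: continuous_subspaceT.
have dG (N x : F) : - N < x -> is_derive x (1 : F) (G N) (f x).
  move=> Nx.
  have xu : x < x + 1 by rewrite ltrDl.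
  have [d1 d2] := continuous_FTC1_closed xu (intf (- N) (x + 1)) Nx (cf x).
  rewrite -(subr0 (f x)) -d2 derive1E.
  apply: is_deriveB; exact: DeriveDef.
have G0 (N : F) : G N 0 = 0 by rewrite /G subrr.
have GG (N M x : F) : 0 < N -> N <= M -> - N < x -> G N x = G M x.
  move=> N0 NM Nx.
  apply/eqP; rewrite -subr_eq0; apply/eqP.
  have dd (z : F) : - N < z -> is_derive z (1:F) (fun y => G N y - G M y) 0.
    move=> Nz; rewrite -(subrr (f z)).
    have ? := dG _ _ Nz.
    have ? : is_derive z (1:F) (G M) (f z).
      by apply: dG; rewrite (le_lt_trans _ Nz)// lerN2.
    exact: is_deriveB.
  have e0 : G N 0 - G M 0 = 0 by rewrite !G0 subrr.
  have [x0|x0] := leP 0 x.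
    rewrite -e0; symmetry; apply: (@eq_of_derive0 (fun y => G N y - G M y)) => // z /andP[z0 _].
    by apply: dd; rewrite (lt_le_trans _ z0)// oppr_lt0.
  rewrite -e0; apply: (@eq_of_derive0 (fun y => G N y - G M y)); first exact: ltW.
  by move=> z /andP[xz _]; apply: dd; rewrite (lt_le_trans Nx).
exists (fun x => G (`|x| + 1) x); split; first exact: G0.
move=> x.
apply: (@near_eq_is_derive _ _ _ (G (`|x| + 2))).
  near=> z; symmetry.
  have zx : `|z| <= `|x| + 1.
    rewrite -lerBlDl; apply: (le_trans (lerB_dist _ _)); apply: ltW.
    by rewrite distrC; near: z; apply: cvgr_dist_lt.
  apply: GG; [by rewrite ltr_wpDl|lra|].
  by rewrite ltrNl (le_lt_trans (ler_norm _))// normrN ltrDl.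
by apply: dG; rewrite ltrNl (le_lt_trans (ler_norm _))// normrN ltrDl.
Unshelve. all: by end_near. Qed.

(** A choice of primitive for every continuous function, which makes the
    Picard iteration below an ordinary function. *)
Lemma primitive_operator : exists P : (F -> F) -> F -> F, forall f, continuous f ->
  P f 0 = 0 /\ forall x : F, is_derive x (1 : F) (P f) (f x).
Proof.
have /choice[P PP] : forall f, exists g : F -> F, continuous f ->
    g 0 = 0 /\ forall x : F, is_derive x (1 : F) g (f x).
  move=> f; have [cf|] := pselect (continuous f); last by exists f.
  by have [g gf] := antiderivative cf; exists g.
by exists P => f cf; exact: PP.
Qed.

Lemma is_derive_reflect f (x d : F) : is_derive (- x) (1 : F) f d ->
  is_derive x (1 : F) (fun y => f (- y)) (- d).
Proof.
move=> fd; rewrite -mulrN1.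
have := @is_derive1_comp F f (fun y => - y) x d (- 1) fd.
by apply; exact: is_deriveNid.
Qed.

(** The weight exp(L|x|) turns integration from 0 into division by L, on the
    whole line at once. *)
Lemma le_exp_of_derive (f df : F -> F) (L K : F) : 0 < L -> f 0 = 0 ->
  (forall x : F, is_derive x (1 : F) f (df x)) ->
  (forall x : F, `|df x| <= L * (K * expR (L * `|x|))) ->
  forall x, `|f x| <= K * expR (L * `|x|).
Proof.
move=> L0.
have pos (g dg : F -> F) : g 0 = 0 ->
  (forall x : F, is_derive x (1 : F) g (dg x)) ->
  (forall x : F, 0 <= x -> dg x <= L * (K * expR (L * x))) ->
  forall x, 0 <= x -> g x <= K * expR (L * x) - K.
  move=> g0 gd dgb x x0.
  have : K * expR (L * 0) - g 0 <= K * expR (L * x) - g x.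
    apply: (le_of_derive_ge0 (f := fun x => K * expR (L * x) - g x)
             (df := fun x => L * (K * expR (L * x)) - dg x)) => //.
      move=> z _; have ? := gd z; apply: is_deriveB.
      have e : is_derive z (1 : F) (fun x : F => expR (L * x)) (expR (L * z) * (L * 1)).
        exact: (@is_derive1_comp F expR (fun x => L * x)).
      have := is_deriveZ K e.
      rewrite (_ : L * (K * _) = K *: (expR (L * z) * (L * 1)))//.
      by rewrite /GRing.scale /= mulr1 mulrCA [expR _ * _]mulrC.
    by move=> z /andP[z0 _]; rewrite subr_ge0 dgb.
  rewrite mulr0 expR0 mulr1 g0 subr0; lra.
move=> f0 fd dfb.
have K0 : 0 <= K.
  have := le_trans (normr_ge0 _) (dfb 0).
  by rewrite normr0 mulr0 expR0 mulr1 pmulr_rge0.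
have absle (g dg : F -> F) : g 0 = 0 ->
  (forall x : F, is_derive x (1 : F) g (dg x)) ->
  (forall x : F, 0 <= x -> `|dg x| <= L * (K * expR (L * x))) ->
  forall x, 0 <= x -> `|g x| <= K * expR (L * x).
  move=> g0 gd dgb x x0; rewrite ler_norml lerNl; apply/andP; split.
    apply: (le_trans (pos (fun x => - g x) (fun x => - dg x) _ _ _ x x0)).
    - by rewrite g0 oppr0.
    - by move=> z z0; apply: le_trans (dgb _ z0); rewrite -normrN ler_norm.
    by rewrite gerBl.
  apply: (le_trans (pos g dg g0 gd _ _ x0)); last by rewrite gerBl.
  by move=> z z0; apply: le_trans (dgb _ z0); rewrite ler_norm.
move=> x; have [x0|x0] := leP 0 x.
  rewrite (ger0_norm x0); apply: (absle f df) => // z z0.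
  by rewrite -[in X in expR X](ger0_norm z0).
rewrite -[x in f x]opprK; rewrite (ltr0_norm x0).
apply: (absle (fun y => f (- y)) (fun y => - df (- y))).
- by rewrite oppr0.
- by move=> z; apply: is_derive_reflect.
- by move=> z z0; rewrite normrN (le_trans (dfb _))// normrN ger0_norm.
- by rewrite oppr_ge0 ltW.
Qed.

Lemma geometric_cauchy_cvg (u : F^nat) (K q : F) : 0 <= q < 1 ->
  (forall n m, (n <= m)%N -> `|u n - u m| <= K * q ^+ n) ->
  exists l, u @ \oo --> l /\ forall n, `|u n - l| <= K * q ^+ n.
Proof.
move=> /andP[q0 q1] cu.
have Kq0 : K * q ^+ n @[n --> \oo] --> (0 : F).
  rewrite -[X in _ --> X](mulr0 K); apply: cvgMr.
  by apply: cvg_expr; rewrite ger0_norm.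
have /cauchy_cvgP ucv : cauchy (u @ \oo).
  apply/cauchy_ballP => e e0; rewrite near_simpl.
  have e20 : 0 < e / 2 by rewrite divr_gt0.
  have [N _ hN] : \forall n \near \oo, `|0 - K * q ^+ n| < e / 2.
    by apply: cvgr_dist_lt.
  near=> p => /=.
  have [p1 p2] : (N <= p.1)%N /\ (N <= p.2)%N.
    by near: p; exists ([set n | (N <= n)%N], [set n | (N <= n)%N]) => //=; split; exists N.
  rewrite /ball /= -(subrKA (u N)) (le_lt_trans (ler_normD _ _))//.
  have kk : `|K * q ^+ N| < e / 2 by rewrite -normrN -sub0r hN/=.
  have := ler_norm (K * q ^+ N).
  have := cu _ _ p1; have := cu _ _ p2; rewrite [X in X <= _ -> _]distrC.
  rewrite (distrC (u p.2)).
  rewrite (distrC (u p.1)). lra.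
exists (lim (u @ \oo)); split => // n.
have : (fun m => `|u n - u m|) @ \oo --> `|u n - lim (u @ \oo)|.
  by apply: cvg_norm; apply: cvgB => //; exact: cvg_cst.
move=> h; apply: (@cvgr_to_le _ _ _ _ _ _ _ h).
by exists n => // m; exact: cu.
Unshelve. all: by end_near. Qed.

Lemma is_derive_finsum (I : finType) (f : I -> F -> F) (df : I -> F) (x : F) :
  (forall i, is_derive x (1 : F) (f i) (df i)) ->
  is_derive x (1 : F) (fun y => \sum_i f i y) (\sum_i df i).
Proof.
move=> fd.
have h := @is_derive_sum F F F #|I| (fun i => f (enum_val i)) x 1 (fun i => df (enum_val i))
  (fun i => fd (enum_val i)).
have reind (g : I -> F) : \sum_i g i = \sum_(i < #|I|) g (enum_val i).
  by rewrite -[RHS](big_enum_val (A := I)); apply: eq_bigl.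
rewrite reind.
rewrite (_ : (fun y => _) = \sum_(i < #|I|) f (enum_val i))//.
by apply/funext => y; rewrite reind fct_sumE.
Qed.

Lemma continuous_finsum (I : finType) (f : I -> F -> F) :
  (forall i, continuous (f i)) -> continuous (fun y => \sum_i f i y).
Proof.
move=> cf x; apply: cvg_big => [|i _]; [exact: add_continuous|exact: cf].
Qed.

End Calculus.

(** * Linear systems of differential equations *)

Section LinearSystem.
Variables (F : realType) (I : finType).
Implicit Types (A : I -> I -> F -> F) (Y : I -> F -> F).

Definition linear_solution A Y :=
  forall i (x : F), is_derive x (1 : F) (Y i) (\sum_j A i j x * Y j x).

Lemma linear_solution_comb A (J : finType) (Y : J -> I -> F -> F) (c : J -> F) :
  (forall j, linear_solution A (Y j)) ->
  linear_solution A (fun i x => \sum_j c j * Y j i x).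
Proof.
move=> sY i x.
rewrite (_ : \sum_j _ = \sum_l c l * \sum_j A i j x * Y l j x); last first.
  under eq_bigr do rewrite big_distrr/=.
  rewrite exchange_big; apply: eq_bigr => l _.
  by rewrite big_distrr; apply: eq_bigr => j _; rewrite /= mulrCA.
by apply: is_derive_finsum => j; have := sY j i x => ?; exact: is_deriveZ.
Qed.

Lemma linear_solutionB A Y Z : linear_solution A Y -> linear_solution A Z ->
  linear_solution A (fun i x => Y i x - Z i x).
Proof.
move=> sY sZ i x.
rewrite (_ : \sum_j _ = \sum_j A i j x * Y j x - \sum_j A i j x * Z j x); last first.
  by rewrite -sumrB; apply: eq_bigr => j _; rewrite mulrBr.
by have := sY i x; have := sZ i x => ? ?; exact: is_deriveB.
Qed.

Variables (A : I -> I -> F -> F) (M : F).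
Hypothesis cA : forall i j, continuous (A i j).
Hypothesis bA : forall i j (x : F), `|A i j x| <= M.

Lemma bound_ge0 (i0 : I) : 0 <= M.
Proof. exact: le_trans (normr_ge0 _) (bA i0 i0 0). Qed.

Lemma system_rhs_le (Y : I -> F) (K x : F) i : (forall j, `|Y j| <= K) ->
  `|\sum_j A i j x * Y j| <= #|I|%:R * (M * K).
Proof.
move=> YK; apply: le_trans (ler_norm_sum _ _ _) _.
rewrite mulr_natl -sumr_const; apply: ler_sum => j _.
by rewrite normrM ler_pM.
Qed.

(** Picard iteration. In the norm weighted by exp(L|x|), with L about twice
    the norm of the system, one step halves distances, so the iterates
    converge on the whole line at once. *)
Lemma linear_solution_exists (y0 : I -> F) :
  exists Y, linear_solution A Y /\ forall i, Y i 0 = y0 i.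
Proof.
have [i0 _|I0] := pickP I; last by exists (fun _ _ => 0); split => i; have := I0 i.
have M0 := bound_ge0 i0.
have [P PP] := primitive_operator F.
pose rhs (Y : I -> F -> F) i x := \sum_j A i j x * Y j x.
have crhs Y : (forall i, continuous (Y i)) -> forall i, continuous (rhs Y i).
  by move=> cY i; apply: continuous_finsum => j x; apply: cvgM; [exact: cA|exact: cY].
pose step (Y : I -> F -> F) i x := y0 i + P (rhs Y i) x.
pose it n := iter n step (fun i _ => y0 i).
have stepd Y : (forall i, continuous (Y i)) ->
    forall i (x : F), is_derive x (1 : F) (step Y i) (rhs Y i x).
  move=> cY i x; have [_ /(_ x) dP] := PP _ (crhs _ cY i).
  by rewrite -[rhs _ _ _]add0r; exact: is_deriveD.
have step0 Y i : (forall i, continuous (Y i)) -> step Y i 0 = y0 i.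
  by move=> cY; rewrite /step; have [-> _] := PP _ (crhs _ cY i); rewrite addr0.
have cstep Y : (forall i, continuous (Y i)) -> forall i, continuous (step Y i).
  by move=> cY i x; exact: is_derive_continuous (stepd _ cY i x).
have cit n : forall i, continuous (it n i).
  by elim: n => [i|n IH]; [exact: cst_continuous|exact: cstep].
pose L : F := 2 * (#|I|%:R * M) + 1.
have L0 : 0 < L by rewrite ltr_wpDl// mulr_ge0// mulr_ge0// ler0n.
pose E (x : F) := expR (L * `|x|).
have contr Y Z K : (forall i, continuous (Y i)) -> (forall i, continuous (Z i)) ->
    0 <= K -> (forall i x, `|Y i x - Z i x| <= 2 * K * E x) ->
    forall i x, `|step Y i x - step Z i x| <= K * E x.
  move=> cY cZ K0 YZ i x.
  apply: (@le_exp_of_derive _ (fun x => step Y i x - step Z i x)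
    (fun x => rhs Y i x - rhs Z i x) L K) => //.
  - by rewrite !step0// subrr.
  - by move=> z; have := stepd _ cY i z; have := stepd _ cZ i z => ? ?; exact: is_deriveB.
  move=> z; rewrite /rhs -sumrB; under eq_bigr do rewrite -mulrBr.
  apply: le_trans (system_rhs_le _ _ _) _; first by move=> j; exact: YZ.
  have e0 : 0 <= K * E z by rewrite mulr_ge0// expR_ge0.
  rewrite -subr_ge0 -/(E z) /L (_ : _ - _ = K * E z)//; ring.
pose K := \sum_i `|y0 i|.
have K0 : 0 <= K by rewrite sumr_ge0.
have itS n i x : `|it n i x - it n.+1 i x| <= K * 2^-1 ^+ n * E x.
  elim: n i x => [|n IH] i x; last first.
    apply: (contr (it n) (it n.+1)); [exact: cit|exact: cit| |].
      by rewrite mulr_ge0// exprn_ge0// invr_ge0.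
    move=> j z; apply: (le_trans (IH j z)); rewrite exprS.
    by rewrite le_eqVlt; apply/orP; left; apply/eqP; by field.
  rewrite expr0 mulr1.
  have [P0 dP] := PP _ (crhs _ (cit 0%N) i).
  rewrite /it/= /step opprD addrA subrr sub0r normrN.
  apply: (le_exp_of_derive L0 P0 dP) => z.
  apply: le_trans (system_rhs_le _ _ _) _.
    move=> j; rewrite /it/=; apply: (@le_trans _ _ K) => //.
    by rewrite /K (bigD1 j)//= lerDl sumr_ge0.
  have e1 : 1 <= E z by rewrite /E -[leLHS]expR0 ler_expR mulr_ge0// ltW.
  have LNM : #|I|%:R * M <= L.
    have : 0 <= #|I|%:R * M by rewrite mulr_ge0// ler0n.
    by rewrite /L; lra.
  rewrite mulrA ler_pM//; first by rewrite mulr_ge0// ler0n.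
  by rewrite ler_peMr.
have itC n m i x : (n <= m)%N -> `|it n i x - it m i x| <= 2 * K * E x * 2^-1 ^+ n.
  have E0 : 0 <= E x by exact: expR_ge0.
  move=> nm; rewrite -(subnK nm); move: (m - n)%N => d {m nm}; elim: d n => [|d IH] n.
    by rewrite add0n subrr normr0 !mulr_ge0// exprn_ge0// invr_ge0.
  rewrite addSnnS.
  rewrite -(subrKA (it n.+1 i x)) (le_trans (ler_normD _ _))//.
  apply: (le_trans (lerD (itS n i x) (IH n.+1))).
  rewrite exprS le_eqVlt; apply/orP; left; apply/eqP; by field.
have /choice[Y YP] : forall i, exists Yi : F -> F, forall x n,
    `|it n i x - Yi x| <= 2 * K * E x * 2^-1 ^+ n.
  move=> i.
  have /choice[Yi YiP] : forall x : F, exists l : F, forall n,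
      `|it n i x - l| <= 2 * K * E x * 2^-1 ^+ n.
    move=> x; have q01 : 0 <= (2^-1 : F) < 1 by lra.
    have [l [_ hl]] := geometric_cauchy_cvg q01 (fun n m => @itC n m i x).
    by exists l.
  by exists Yi.
have half0 (c : F) : c * 2^-1 ^+ n @[n --> \oo] --> (0 : F).
  rewrite -[X in _ --> X](mulr0 c); apply: cvgMr.
  by apply: cvg_expr; rewrite ger0_norm; lra.
(* The iterates converge uniformly on bounded sets, hence to a continuous
   limit. *)
have cY i : continuous (Y i).
  move=> x; apply/cvgrPdist_lt => e e0.
  pose B := 2 * K * expR (L * (`|x| + 1)).
  have B0 : 0 <= B by rewrite !mulr_ge0// expR_ge0.
  have [N _ /(_ N (leqnn N)) hN] : \forall n \near \oo, `|0 - B * 2^-1 ^+ n| < e / 3.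
    by apply: cvgr_dist_lt; rewrite // divr_gt0.
  have YN z : `|z| <= `|x| + 1 -> `|it N i z - Y i z| < e / 3.
    move=> zx; apply: le_lt_trans hN; rewrite sub0r normrN [leRHS]ger0_norm; last first.
      by rewrite mulr_ge0// exprn_ge0// invr_ge0.
    apply: (le_trans (YP i z N)); rewrite ler_wpM2r ?exprn_ge0 ?invr_ge0//.
    by rewrite ler_wpM2l ?mulr_ge0// ler_expR ler_pM2l.
  near=> z.
  have zx : `|z| <= `|x| + 1.
    rewrite -lerBlDl; apply: (le_trans (lerB_dist _ _)); apply: ltW.
    by rewrite distrC; near: z; apply: cvgr_dist_lt.
  have h1 := YN z zx; have h2 : `|it N i x - Y i x| < e / 3 by apply: YN; rewrite lerDl.
  have h3 : `|it N i x - it N i z| < e / 3.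
    by near: z; apply: cvgr_dist_lt; [exact: cit|rewrite divr_gt0].
  rewrite -(subrKA (it N i x)) (le_lt_trans (ler_normD _ _))//.
  rewrite -(subrKA (it N i z) (it N i x)).
  rewrite (le_lt_trans (lerD (lexx _) (ler_normD _ _)))//.
  rewrite distrC; lra.
(* Both sides are within a multiple of 2^-n from the iterate of index n + 1. *)
have YE : Y = step Y.
  apply/funext => i; apply/funext => x; apply/eqP; rewrite -subr_eq0 -normr_le0.
  have E0 : 0 <= E x by exact: expR_ge0.
  have h : cst (`|Y i x - step Y i x|) @ \oo --> (`|Y i x - step Y i x| : F) by exact: cvg_cst.
  apply: (ler_cvg_to h (half0 (2 * K * E x))); near=> n => /=.
  rewrite -(subrKA (it n.+1 i x)) (le_trans (ler_normD _ _))//.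
  have h1 := YP i x n.+1; rewrite distrC in h1.
  have h2 : `|it n.+1 i x - step Y i x| <= K * 2^-1 ^+ n * E x.
    apply: (contr (it n) Y); [exact: cit|exact: cY| |].
      by rewrite mulr_ge0// exprn_ge0// invr_ge0.
    move=> j z; apply: (le_trans (YP j z n)).
    by rewrite le_eqVlt; apply/orP; left; apply/eqP; ring.
  apply: (le_trans (lerD h1 h2)); rewrite exprS le_eqVlt; apply/orP; left; apply/eqP; by field.
exists Y; split; first by move=> i x; rewrite {1}YE; exact: stepd.
by move=> i; rewrite YE step0.
Unshelve. all: by end_near. Qed.

End LinearSystem.

Lemma solvable_of_injective (F : fieldType) (I : finType) (T : I -> I -> F) :
  (forall y, (forall i, \sum_j T i j * y j = 0) -> forall j, y j = 0) ->
  forall b, exists y, forall i, \sum_j T i j * y j = b i.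
Proof.
move=> injT b.
have reind (g : I -> F) : \sum_i g i = \sum_(i < #|I|) g (enum_val i).
  by rewrite -[RHS](big_enum_val (A := I)); apply: eq_bigl.
pose Q : 'M[F]_#|I| := (\matrix_(i, j) T (enum_val i) (enum_val j))^T.
have Qu : Q \in unitmx.
  rewrite -row_free_unit; apply: inj_row_free => v vQ0.
  apply/rowP => i; rewrite mxE.
  rewrite -(enum_valK i); apply: (injT (fun j => v ord0 (enum_rank j))) => l.
  have /rowP/(_ (enum_rank l)) := vQ0; rewrite !mxE => h; rewrite -[RHS]h.
  rewrite reind; apply: eq_bigr => j _.
  by rewrite !mxE enum_rankK enum_valK mulrC.
pose v := (\row_j b (enum_val j)) *m invmx Q.
exists (fun j => v ord0 (enum_rank j)) => i.
have /rowP/(_ (enum_rank i)) : v *m Q = \row_j b (enum_val j) by rewrite mulmxKV.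
rewrite !mxE enum_rankK => <-.
rewrite reind; apply: eq_bigr => j _.
by rewrite !mxE enum_rankK enum_valK mulrC.
Qed.

(** * Systems with monotone indefinite energies *)

Section Dichotomy.
Variables (F : realType) (I : finType).
Implicit Types (A : I -> I -> F -> F) (Y : I -> F -> F).

Definition cone_weight (unstable : pred I) (al be : F) (i : I) : F :=
  if unstable i then al else - be.

Definition energy (unstable : pred I) (al be : F) (y : I -> F) : F :=
  \sum_i cone_weight unstable al be i * y i ^+ 2.

(** Half the derivative of each energy along a solution dominates the
    squared norm. A range of weights is required, and not only al = be = 1:
    comparing the signs of two different energies bounds the unstable part
    by a fraction of the stable part, or conversely. *)
Definition dichotomy A (unstable : pred I) (c : F) :=
  forall (al be x : F) (y : I -> F), 1 <= al <= 2 -> 1 <= be <= 2 ->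
  c * \sum_i y i ^+ 2 <=
    \sum_i cone_weight unstable al be i * (y i * \sum_j A i j x * y j).

Variables (A : I -> I -> F -> F) (M c : F) (sg : pred I).
Hypothesis cA : forall i j, continuous (A i j).
Hypothesis bA : forall i j (x : F), `|A i j x| <= M.
Hypothesis c0 : 0 < c.
Hypothesis dich : dichotomy A sg c.

Lemma energyN (al be : F) (y : I -> F) :
  energy (predC sg) al be y = - energy sg be al y.
Proof.
rewrite /energy -sumrN; apply: eq_bigr => i _.
by rewrite /cone_weight /=; case: (sg i); rewrite /= ?mulNr ?opprK.
Qed.

(** Reversing the direction of x exchanges stable and unstable coordinates;
    every statement at +oo thus has a counterpart at -oo. *)
Lemma dichotomy_reflect : dichotomy (fun i j x => - A i j (- x)) (predC sg) c.
Proof.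
move=> al be x y h1 h2; apply: le_trans (dich (- x) y h2 h1) _.
rewrite le_eqVlt; apply/orP; left; apply/eqP; apply: eq_bigr => i _.
under [in RHS]eq_bigr do rewrite mulNr.
by rewrite sumrN /cone_weight /=; case: (sg i); rewrite /= ?mulNr ?mulrN ?opprK.
Qed.

Lemma derive_energy Y (w : I -> F) (x : F) : linear_solution A Y ->
  is_derive x (1 : F) (fun z => \sum_i w i * Y i z ^+ 2)
    (2 * \sum_i w i * (Y i x * \sum_j A i j x * Y j x)).
Proof.
move=> sY; rewrite big_distrr /=; apply: is_derive_finsum => i.
have dYi := sY i x.
apply: (is_derive_eq (is_deriveZ (w i) (is_deriveM dYi dYi))).
rewrite /GRing.scale /=; ring.
Qed.

Lemma energy_nondecreasing Y al be (x z : F) : linear_solution A Y ->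
  1 <= al <= 2 -> 1 <= be <= 2 -> x <= z ->
  energy sg al be (Y^~ x) <= energy sg al be (Y^~ z).
Proof.
move=> sY h1 h2 xz.
apply: (le_of_derive_ge0 xz (fun t _ => derive_energy (cone_weight sg al be) t sY)).
move=> t _; rewrite mulr_ge0//; apply: le_trans (dich _ _ h1 h2).
by rewrite mulr_ge0 ?(ltW c0)// sumr_ge0// => i _; exact: sqr_ge0.
Qed.

Lemma energy_abs_le (y : I -> F) : `|energy sg 1 1 y| <= \sum_i y i ^+ 2.
Proof.
apply: le_trans (ler_norm_sum _ _ _) _; apply: ler_sum => i _.
by rewrite /cone_weight; case: (sg i); rewrite ?mulNr mul1r ?normrN ger0_norm ?sqr_ge0.
Qed.

(** The derivative of the energy is at least 2 c |Y|^2, and |Y|^2 bounds the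
    absolute value of the energy; so it also absorbs the derivative of the
    exponential factor, whatever the sign of k. *)
Lemma exp_energy_nondecreasing Y (k x z : F) : linear_solution A Y ->
  `|k| <= 2 * c -> x <= z ->
  expR (k * x) * energy sg 1 1 (Y^~ x) <= expR (k * z) * energy sg 1 1 (Y^~ z).
Proof.
move=> sY kc xz.
have de (t : F) : is_derive t (1 : F) (fun s => expR (k * s)) (expR (k * t) * (k * 1)).
  exact: (@is_derive1_comp F expR (fun s => k * s)).
have dE t := derive_energy (cone_weight sg 1 1) t sY.
apply: (le_of_derive_ge0 xz (fun t _ => is_deriveM (de t) (dE t))) => t _.
rewrite /GRing.scale /= mulr1 [_ * (expR _ * _)]mulrCA -mulrDr mulr_ge0 ?expR_ge0//.
have one : 1 <= (1 : F) <= 2 by lra.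
have := dich t (Y^~ t) one one.
have := energy_abs_le (Y^~ t); rewrite /energy.
set E := \sum_i _ * _ ^+ 2; set N := \sum_i _ ^+ 2; set D := \sum_i _ * (_ * _).
move=> EN ND.
have : `|E * k| <= N * (2 * c) by rewrite normrM ler_pM.
by rewrite ler_norml => /andP[+ _]; lra.
Qed.

(** A nondecreasing function that tends to 0 at +oo is nonpositive. *)
Lemma decaying_energy_le0 Y al be (x : F) : linear_solution A Y ->
  (forall i, Y i z @[z --> +oo] --> (0 : F)) ->
  1 <= al <= 2 -> 1 <= be <= 2 -> energy sg al be (Y^~ x) <= 0.
Proof.
move=> sY dY h1 h2.
have cE : energy sg al be (Y^~ z) @[z --> +oo] --> (0 : F).
  rewrite [X in _ --> X](_ : 0 = \sum_i cone_weight sg al be i * 0 ^+ 2); last first.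
    by rewrite big1// => i _; rewrite expr0n mulr0.
  apply: cvg_big => [|i _]; first exact: add_continuous.
  by apply: cvgMr; exact: (cvgM (dY i) (dY i)).
apply: (cvgr_to_ge cE); near=> z.
by apply: energy_nondecreasing => //; near: z; exact: nbhs_pinfty_ge.
Unshelve. all: by end_near. Qed.

Lemma energy_stable0 al be (y : I -> F) : (forall i, ~~ sg i -> y i = 0) ->
  energy sg al be y = al * \sum_i y i ^+ 2.
Proof.
move=> y0; rewrite big_distrr; apply: eq_bigr => i _ /=.
rewrite /cone_weight; case: ifPn => // /y0 ->.
by rewrite expr0n !mulr0.
Qed.

Lemma energy_unstable0 al be (y : I -> F) : (forall i, sg i -> y i = 0) ->
  energy sg al be y = - be * \sum_i y i ^+ 2.
Proof.
move=> y0; rewrite big_distrr; apply: eq_bigr => i _ /=.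
rewrite /cone_weight; case: ifPn => // /y0 ->.
by rewrite expr0n !mulr0.
Qed.

Lemma sumsqr_le0 (y : I -> F) : \sum_i y i ^+ 2 <= 0 -> forall i, y i = 0.
Proof.
move=> h i; apply/eqP; rewrite -sqrf_eq0; apply/eqP.
have s0 : forall i : I, true -> 0 <= y i ^+ 2 by move=> ? _; exact: sqr_ge0.
have /eqP : \sum_i y i ^+ 2 = 0 by apply/eqP; rewrite eq_le h sumr_ge0.
by rewrite psumr_eq0// => /allP/(_ i); rewrite mem_index_enum => /(_ isT)/eqP.
Qed.

(** Gronwall: multiplied by a suitable exponential, the squared norm becomes
    monotone in either direction. *)
Lemma linear_solution_unique0 Y : linear_solution A Y ->
  (forall i, Y i 0 = 0) -> forall i x, Y i x = 0.
Proof.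
move=> sY Y0.
have [i0 _|I0] := pickP I; last by move=> i; have := I0 i.
have M0 : 0 <= M by exact: bound_ge0 bA i0.
pose N (x : F) := \sum_i 1 * Y i x ^+ 2.
have N0 x : 0 <= N x by apply: sumr_ge0 => i _; rewrite mul1r sqr_ge0.
have dN x := derive_energy (fun=> 1) x sY.
pose D (x : F) := \sum_i 1 * (Y i x * \sum_j A i j x * Y j x).
pose B := #|I|%:R * M.
have DB x : `|D x| <= B * N x.
  apply: le_trans (ler_norm_sum _ _ _) _.
  apply: (@le_trans _ _ (\sum_i \sum_j M * ((Y i x ^+ 2 + Y j x ^+ 2) / 2))).
    apply: ler_sum => i _; rewrite mul1r big_distrr/=.
    apply: le_trans (ler_norm_sum _ _ _) _; apply: ler_sum => j _.
    rewrite mulrCA normrM ler_pM//; rewrite normrM.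
    rewrite -(real_normK (num_real (Y i x))) -(real_normK (num_real (Y j x))).
    have := sqr_ge0 (`|Y i x| - `|Y j x|). nra.
  rewrite le_eqVlt; apply/orP; left; apply/eqP.
  under eq_bigr do rewrite -big_distrr/= -big_distrl/= big_split/= sumr_const.
  rewrite -big_distrr/= -big_distrl/= big_split/= sumr_const sumrMnl.
  rewrite /N /B; under [in RHS]eq_bigr do rewrite mul1r.
  set S := \sum_i Y i x ^+ 2; rewrite -[#|xpredT|]/#|I| -(mulr_natl S); by field.
have NE k x : is_derive x (1 : F) (fun s => expR (k * s) * N s)
    (expR (k * x) * (2 * D x + k * N x)).
  have de : is_derive x (1 : F) (fun s => expR (k * s)) (expR (k * x) * (k * 1)).
    exact: (@is_derive1_comp F expR (fun s => k * s)).
  have := is_deriveM de (dN x); rewrite /GRing.scale /= mulr1.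
  by rewrite [_ * (expR _ * _)]mulrCA -mulrDr [_ * k]mulrC.
have NZ x : N x = 0.
  apply/eqP; rewrite eq_le N0 andbT.
  have N00 : N 0 = 0 by rewrite /N big1// => i _; rewrite Y0 expr0n mulr0.
  have B0 : 0 <= B by rewrite mulr_ge0// ler0n.
  have [x0|x0] := leP 0 x.
    have : - (expR (- (2 * B) * 0) * N 0) <= - (expR (- (2 * B) * x) * N x).
      apply: (le_of_derive_ge0 x0 (fun t _ => is_deriveN (NE (- (2 * B)) t))) => t _.
      rewrite -mulrN mulr_ge0 ?expR_ge0//; have := DB t; rewrite ler_norml; nra.
    by rewrite N00 mulr0 oppr0 oppr_ge0 pmulr_rle0 ?expR_gt0.
  have : expR (2 * B * x) * N x <= expR (2 * B * 0) * N 0.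
    apply: (le_of_derive_ge0 (ltW x0) (fun t _ => NE (2 * B) t)) => t _.
    rewrite mulr_ge0 ?expR_ge0//; have := DB t; rewrite ler_norml; nra.
  by rewrite N00 mulr0 pmulr_rle0 ?expR_gt0.
move=> i x; apply: (@sumsqr_le0 (Y^~ x)).
by rewrite -[leRHS](NZ x); apply: ler_sum => j _; rewrite mul1r.
Qed.

Lemma energyE al be (y : I -> F) :
  energy sg al be y = al * (\sum_(i | sg i) y i ^+ 2) - be * (\sum_(i | ~~ sg i) y i ^+ 2).
Proof.
rewrite -mulNr !big_distrr /energy (bigID sg)/=.
congr (_ + _); apply: eq_bigr => i h; rewrite /cone_weight ?h//.
by rewrite (negPf h).
Qed.

(** The decaying solution is the limit of the solutions Y_n with stable part
    xi at 0 and no unstable part at n. The energies of Y_n are nonpositive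
    up to n. The difference of Y_n and Y_m has no stable part at 0, so its
    energy there is the squared distance of the initial values, and by
    growth it is at most exp(- 2 c n) times its energy at n, which is
    bounded in terms of xi. In the limit all energies stay nonpositive, the
    growth of the energy makes it decay exponentially, and the energy with
    weights (2, 1) lets it control the norm. *)
Lemma decaying_solution_exists (xi : I -> F) :
  exists Y, [/\ linear_solution A Y, forall i, ~~ sg i -> Y i 0 = xi i
    & forall i, Y i z @[z --> +oo] --> (0 : F)].
Proof.
have /choice[Phi PhiP] : forall j : I, exists Y, linear_solution A Y /\
    forall i, Y i 0 = (i == j)%:R.
  by move=> j; exact: (linear_solution_exists cA bA).
pose sol (y : I -> F) i x := \sum_j y j * Phi j i x.
have sS y : linear_solution A (sol y).
  by apply: linear_solution_comb => j; have [] := PhiP j.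
have s0 y i : sol y i 0 = y i.
  rewrite /sol (bigD1 i)//= big1 ?addr0; last first.
    by move=> j ji; have [_ ->] := PhiP j; rewrite eq_sym (negPf ji) mulr0.
  by have [_ ->] := PhiP i; rewrite eqxx mulr1.
have one : 1 <= (1 : F) <= 2 by lra.
have two : 1 <= (2 : F) <= 2 by lra.
have nonneg (P : pred I) (y : I -> F) : 0 <= \sum_(i | P i) y i ^+ 2.
  by rewrite sumr_ge0// => i _; exact: sqr_ge0.
(* A vector with no stable part at 0 and no unstable part at n is zero,
   since its energy cannot decrease; this makes the boundary value problem
   solvable. *)
have /choice[y yP] : forall n : nat, exists y : I -> F,
    (forall i, ~~ sg i -> y i = xi i) /\ (forall i, sg i -> sol y i n%:R = 0).
  move=> n.
  pose T i j := if sg i then Phi j i n%:R else (i == j)%:R.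
  have TE y i : \sum_j T i j * y j = if sg i then sol y i n%:R else y i.
    rewrite /T; case: (sg i); first by apply: eq_bigr => j _; rewrite mulrC.
    rewrite (bigD1 i)//= big1 ?addr0 ?eqxx ?mul1r// => j.
    by rewrite eq_sym => /negPf ->; rewrite mul0r.
  have [|y yT] := @solvable_of_injective F I T _ (fun i => if sg i then 0 else xi i).
    move=> y Ty.
    have h1 i : ~~ sg i -> y i = 0.
      by move=> si; have := Ty i; rewrite TE (negPf si).
    have h2 i : sg i -> sol y i n%:R = 0.
      by move=> si; have := Ty i; rewrite TE si.
    have := energy_nondecreasing (sS y) one one (ler0n F n).
    rewrite (@energy_unstable0 _ _ (_^~ n%:R))// energy_stable0; last first.
      by move=> i si; rewrite s0 h1.
    rewrite mul1r => h; apply: sumsqr_le0.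
    under eq_bigr do rewrite -s0.
    by apply: le_trans h _; rewrite mulN1r oppr_le0.
  exists y; split => i si; have := yT i; rewrite TE ?si//.
  by rewrite (negPf si).
have neg n (x al be : F) : x <= n%:R -> 1 <= al <= 2 -> 1 <= be <= 2 ->
    energy sg al be (sol (y n) ^~ x) <= 0.
  move=> xn h1 h2; apply: le_trans (energy_nondecreasing (sS _) h1 h2 xn) _.
  rewrite energy_unstable0; last by have [] := yP n.
  rewrite mulNr oppr_le0 mulr_ge0//; lra.
pose X := \sum_i xi i ^+ 2.
have X0 : 0 <= X by exact: nonneg.
pose q := expR (- c).
have q01 : 0 <= q < 1 by rewrite expR_ge0 /q expR_lt1 oppr_lt0.
have qn n : q ^+ n = expR (- c * n%:R) by rewrite -expRM_natr.
(* Let u and v be the squared unstable and stable parts of Y_m at n: 2 u <=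
   v, and u - v is at least its value at 0, so u <= |xi|^2. *)
have ycauchy i n m : (n <= m)%N -> `|y n i - y m i| <= (1 + X) * q ^+ n.
  move=> nm.
  have stab j : ~~ sg j -> sol (y n) j 0 - sol (y m) j 0 = 0.
    by move=> sj; rewrite !s0; have [-> // _] := yP n; have [-> // _] := yP m; rewrite subrr.
  have D := linear_solutionB (sS (y n)) (sS (y m)).
  have kc : `|- (2 * c)| <= 2 * c by rewrite normrN ger0_norm// mulr_ge0// ltW.
  have := exp_energy_nondecreasing D kc (ler0n F n).
  rewrite mulr0 expR0 mul1r (@energy_stable0 _ _ (fun j => _ j 0 - _ j 0))// mul1r.
  rewrite energyE !mul1r.
  have -> : \sum_(j | sg j) (sol (y n) j n%:R - sol (y m) j n%:R) ^+ 2
      = \sum_(j | sg j) sol (y m) j n%:R ^+ 2.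
    apply: eq_bigr => j sj; have [_ /(_ j sj) ->] := yP n.
    by rewrite sub0r sqrrN.
  have nmR : (n%:R : F) <= m%:R by rewrite ler_nat.
  have := neg m n%:R 2 1 nmR two one; rewrite energyE mul1r.
  have := energy_nondecreasing (sS (y m)) one one (ler0n F n); rewrite !energyE !mul1r.
  have V0 : \sum_(j | ~~ sg j) sol (y m) j 0 ^+ 2 <= X.
    rewrite /X [leRHS](bigID sg)/= addrC ler_wpDr//.
    by apply: ler_sum => j sj; rewrite s0; have [-> // _] := yP m.
  have := nonneg sg (sol (y m) ^~ 0).
  have := nonneg (predC sg) (fun j => sol (y n) j n%:R - sol (y m) j n%:R) => /=.
  move: V0.
  set u0 := \sum_(j | sg j) _ ^+ 2; set v0 := \sum_(j | ~~ sg j) sol _ _ 0 ^+ 2.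
  set v1 := \sum_(j | ~~ sg j) (_ - _) ^+ 2.
  set u := \sum_(j | sg j) sol _ _ n%:R ^+ 2; set v := \sum_(j | ~~ sg j) sol _ _ n%:R ^+ 2.
  move=> V0 V1 U0 UV neg21 D0.
  have uX : u - v1 <= X by lra.
  have qq : expR (- (2 * c) * n%:R) = (q ^+ n) ^+ 2.
    by rewrite qn -expRM_natr; congr expR; ring.
  rewrite qq in D0.
  rewrite -(@ler_pXn2r _ 2%N) ?nnegrE//; last first.
    by rewrite mulr_ge0 ?addr_ge0// exprn_ge0//; case/andP: q01.
  have q2 : 0 <= (q ^+ n) ^+ 2 by exact: sqr_ge0.
  rewrite real_normK ?num_real// exprMn.
  apply: (@le_trans _ _ ((q ^+ n) ^+ 2 * X)); last first.
    rewrite mulrC ler_wpM2r//; nra.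
  apply: le_trans (ler_wpM2l q2 uX); apply: le_trans D0.
  rewrite (bigD1 i)//= !s0 lerDl; exact: nonneg.
have /choice[yl ylP] : forall i, exists l : F, y n i @[n --> \oo] --> (l : F).
  move=> i; have [l [yl _]] := geometric_cauchy_cvg q01 (fun n m => @ycauchy i n m).
  by exists l.
exists (sol yl); split => //.
  move=> i si; rewrite s0.
  have h : y n i @[n --> \oo] --> xi i.
    by apply: cvg_near_cst; apply: nearW => n; have [-> //] := yP n.
  exact: (cvg_unique _ (ylP i) h).
(* The energies of the limit are nonpositive at x, because those of Y_n are
   as soon as x <= n. *)
have negl (x al be : F) : 0 <= x -> 1 <= al <= 2 -> 1 <= be <= 2 ->
    energy sg al be (sol yl ^~ x) <= 0.
  move=> x0 h1 h2.
  have cs i : sol (y n) i x @[n --> \oo] --> sol yl i x.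
    apply: cvg_big => [|j _]; first exact: add_continuous.
    by apply: cvgMl; exact: ylP.
  have cE : energy sg al be (sol (y n) ^~ x) @[n --> \oo] --> energy sg al be (sol yl ^~ x).
    apply: cvg_big => [|i _]; first exact: add_continuous.
    by apply: cvgMr; exact: (cvgM (cs i) (cs i)).
  apply: (cvgr_to_le cE); near=> n.
  apply: neg => //; near: n; exact: nbhs_infty_ger.
pose B := 1 - 3 * energy sg 1 1 (sol yl ^~ 0).
have B1 : 1 <= B by have := negl 0 1 1 (lexx _) one one; rewrite /B; lra.
have dec i (x : F) : 0 <= x -> `|sol yl i x| <= B * expR (- (c * x)).
  move=> x0; rewrite -(@ler_pXn2r _ 2%N) ?nnegrE ?mulr_ge0 ?expR_ge0//; try lra.
  rewrite real_normK ?num_real// exprMn.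
  have kc : `|2 * c| <= 2 * c by rewrite ger0_norm// mulr_ge0// ltW.
  have := exp_energy_nondecreasing (sS yl) kc x0.
  rewrite mulr0 expR0 mul1r => E0.
  have := negl x 2 1 x0 two one; rewrite energyE mul1r.
  move: E0; rewrite [in X in _ <= _ * X]energyE !mul1r.
  have ee : expR (2 * c * x) * expR (- (c * x)) ^+ 2 = 1.
    rewrite -expRM_natr -expRD -[RHS]expR0; congr expR; ring.
  have : sol yl i x ^+ 2 <= \sum_(i | sg i) sol yl i x ^+ 2 + \sum_(i | ~~ sg i) sol yl i x ^+ 2.
    rewrite -(bigID sg predT (fun i => sol yl i x ^+ 2))/= (bigD1 i)//= lerDl; exact: nonneg.
  set u := \sum_(j | sg j) _; set v := \sum_(j | ~~ sg j) _.
  move=> uv E0 uv2.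
  have e20 : 0 <= expR (- (c * x)) ^+ 2 by exact: sqr_ge0.
  apply: (@le_trans _ _ (3 * (v - u))); first by lra.
  have -> : 3 * (v - u) = - 3 * (expR (2 * c * x) * (u - v)) * expR (- (c * x)) ^+ 2.
    rewrite -mulrA mulrAC ee; ring.
  apply: ler_wpM2r => //.
  apply: (@le_trans _ _ B); first by rewrite /B; lra.
  by rewrite expr2 ler_peMr//; lra.
move=> i.
apply/norm_cvg0P.
have cexp : B * expR (- (c * z)) @[z --> +oo] --> (0 : F).
  rewrite -[X in _ --> X](mulr0 B); apply: cvgMr.
  exact: (cvg_comp _ _ (gt0_cvgMry c0 cvg_id) (@cvgr_expR F)).
apply: (squeeze_cvgr _ (cvg_cst 0) cexp).
near=> z; rewrite normr_ge0/=; apply: dec; near: z.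
exact: nbhs_pinfty_ge.
Unshelve. all: by end_near. Qed.

End Dichotomy.

Section Reflection.
Variables (F : realType) (I : finType) (A : I -> I -> F -> F) (M c : F) (sg : pred I).
Hypothesis cA : forall i j, continuous (A i j).
Hypothesis bA : forall i j (x : F), `|A i j x| <= M.
Hypothesis c0 : 0 < c.
Hypothesis dich : dichotomy A sg c.
Let B i j (x : F) := - A i j (- x).

Lemma linear_solution_reflect Y : linear_solution A Y ->
  linear_solution B (fun i x => Y i (- x)).
Proof.
move=> sY i x; rewrite /B; under eq_bigr do rewrite mulNr.
by rewrite sumrN; apply: is_derive_reflect; exact: sY.
Qed.

Lemma linear_solution_reflectK Y : linear_solution B Y ->
  linear_solution A (fun i x => Y i (- x)).
Proof.
move=> sY i x; rewrite (_ : \sum_j _ = - \sum_j B i j (- x) * Y j (- x)).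
  by apply: is_derive_reflect; exact: sY.
by rewrite -sumrN; apply: eq_bigr => j _; rewrite /B opprK mulNr opprK.
Qed.

Lemma reflect_continuous i j : continuous (B i j).
Proof.
move=> x; apply: cvgN; apply: (@continuous_comp _ _ _ -%R (A i j)).
  exact: opp_continuous.
exact: cA.
Qed.

Lemma reflect_bounded i j (x : F) : `|B i j x| <= M.
Proof. by rewrite /B normrN. Qed.

Lemma decaying_solution_exists_ninfty (xi : I -> F) :
  exists Y, [/\ linear_solution A Y, forall i, sg i -> Y i 0 = xi i
    & forall i, Y i z @[z --> -oo] --> (0 : F)].
Proof.
have [Y [sY Y0 dY]] :=
  decaying_solution_exists reflect_continuous reflect_bounded c0
    (dichotomy_reflect dich) xi.
exists (fun i x => Y i (- x)); split; first exact: linear_solution_reflectK.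
  by move=> i si; rewrite oppr0 Y0//= si.
move=> i; apply/cvgNy_compNP; rewrite (_ : _ \o _ = Y i)//.
by apply/funext => x /=; rewrite opprK.
Qed.

Lemma decaying_energy_ge0 Y al be (x : F) : linear_solution A Y ->
  (forall i, Y i z @[z --> -oo] --> (0 : F)) ->
  1 <= al <= 2 -> 1 <= be <= 2 -> 0 <= energy sg al be (Y^~ x).
Proof.
move=> sY dY h1 h2.
have := @decaying_energy_le0 F I B c (predC sg) c0 (dichotomy_reflect dich)
  _ be al (- x) (linear_solution_reflect sY) _ h2 h1.
rewrite energyN opprK oppr_le0; apply.
by move=> i; apply/cvgNy_compNP.
Qed.

(** Without stable part at 0 the energy there is the squared norm, and it is
    nonpositive. *)
Lemma decaying_eq0_pinfty Y : linear_solution A Y ->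
  (forall i, Y i z @[z --> +oo] --> (0 : F)) ->
  (forall i, ~~ sg i -> Y i 0 = 0) -> forall i x, Y i x = 0.
Proof.
move=> sY dY Y0; apply: (linear_solution_unique0 bA) => //.
have one : 1 <= (1 : F) <= 2 by lra.
have := decaying_energy_le0 c0 dich 0 sY dY one one.
by rewrite energy_stable0// mul1r => /sumsqr_le0.
Qed.

Lemma decaying_eq0_ninfty Y : linear_solution A Y ->
  (forall i, Y i z @[z --> -oo] --> (0 : F)) ->
  (forall i, sg i -> Y i 0 = 0) -> forall i x, Y i x = 0.
Proof.
move=> sY dY Y0; apply: (linear_solution_unique0 bA) => //.
have one : 1 <= (1 : F) <= 2 by lra.
have := decaying_energy_ge0 0 sY dY one one.
by rewrite energy_unstable0// mulN1r oppr_ge0 => /sumsqr_le0.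
Qed.

(** At the common value the energy with weights (2, 1) is nonpositive and
    the energy with weights (1, 2) is nonnegative; only the zero vector
    satisfies both. *)
Lemma decaying_both_eq0 V W : linear_solution A V -> linear_solution A W ->
  (forall i, V i z @[z --> -oo] --> (0 : F)) ->
  (forall i, W i z @[z --> +oo] --> (0 : F)) ->
  (forall i, V i 0 = W i 0) -> forall i, V i 0 = 0.
Proof.
move=> sV sW dV dW VW.
have one : 1 <= (1 : F) <= 2 by lra.
have two : 1 <= (2 : F) <= 2 by lra.
have := decaying_energy_ge0 0 sV dV one two.
have := decaying_energy_le0 c0 dich 0 sW dW two one.
have -> : W^~ 0 = V^~ 0 by apply/funext => i; rewrite VW.
rewrite !energyE => h1 h2; apply: sumsqr_le0.
rewrite (bigID sg)/=; move: h1 h2.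
have : 0 <= \sum_(i | sg i) V i 0 ^+ 2 by apply: sumr_ge0 => i _; exact: sqr_ge0.
have : 0 <= \sum_(i | ~~ sg i) V i 0 ^+ 2 by apply: sumr_ge0 => i _; exact: sqr_ge0.
lra.
Qed.

End Reflection.

(** * Complex systems as real systems *)

Section ComplexReal.
Variable F : realType.
Local Notation C := F[i].
Local Notation Re := complex.Re.
Local Notation Im := complex.Im.

Lemma ReD (x y : C) : Re (x + y) = Re x + Re y. Proof. by case: x y => ? ? []. Qed.
Lemma ImD (x y : C) : Im (x + y) = Im x + Im y. Proof. by case: x y => ? ? []. Qed.
Lemma ReM (x y : C) : Re (x * y) = Re x * Re y - Im x * Im y.
Proof. by case: x y => ? ? []. Qed.
Lemma ImM (x y : C) : Im (x * y) = Re x * Im y + Im x * Re y.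
Proof. by case: x y => ? ? []. Qed.
Lemma Re_sum (J : Type) (r : seq J) P (f : J -> C) :
  Re (\sum_(j <- r | P j) f j) = \sum_(j <- r | P j) Re (f j).
Proof. exact: (big_morph _ ReD). Qed.
Lemma Im_sum (J : Type) (r : seq J) P (f : J -> C) :
  Im (\sum_(j <- r | P j) f j) = \sum_(j <- r | P j) Im (f j).
Proof. exact: (big_morph _ ImD). Qed.

Variable n : nat.
Implicit Types (z : 'cV[C]_n) (A P : 'M[C]_n).

Definition realvec z (p : 'I_n * bool) : F :=
  if p.2 then Im (z p.1 0) else Re (z p.1 0).

Definition realmx A (p q : 'I_n * bool) : F :=
  if p.2 == q.2 then Re (A p.1 q.1)
  else if p.2 then Im (A p.1 q.1) else - Im (A p.1 q.1).

Definition cplxvec (y : 'I_n * bool -> F) : 'cV[C]_n :=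
  \col_i (Complex (y (i, false)) (y (i, true))).

Lemma cplxvecK y : realvec (cplxvec y) = y.
Proof. by apply/funext => -[i []]; rewrite /realvec mxE. Qed.

Lemma realvecK z : cplxvec (realvec z) = z.
Proof. by apply/colP => i; rewrite mxE /realvec/=; case: (z i 0). Qed.

Lemma sum_pair_bool (f : 'I_n * bool -> F) :
  \sum_p f p = \sum_i (f (i, false) + f (i, true)).
Proof.
transitivity (\sum_i \sum_b f (i, b)).
  by rewrite pair_bigA; apply: eq_bigr => -[].
by apply: eq_bigr => i _; rewrite big_bool addrC.
Qed.

Lemma realvec_mulmx A z p :
  realvec (A *m z) p = \sum_q realmx A p q * realvec z q.
Proof.
rewrite sum_pair_bool; case: p => i []; rewrite /realvec /realmx/= !mxE.
  by rewrite Im_sum; apply: eq_bigr => j _; rewrite ImM addrC.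
by rewrite Re_sum; apply: eq_bigr => j _; rewrite ReM mulNr.
Qed.

Lemma realvecD z1 z2 p : realvec (z1 + z2) p = realvec z1 p + realvec z2 p.
Proof. by rewrite /realvec !mxE ReD ImD; case: ifP. Qed.

Lemma realvec_eq0 z : (forall p, realvec z p = 0) -> z = 0.
Proof.
move=> z0; rewrite -(realvecK z); apply/colP => i.
by rewrite !mxE !z0.
Qed.

Lemma realvec0 p : realvec 0 p = 0.
Proof. by rewrite /realvec mxE; case: ifP. Qed.

Lemma mx_is_deriveE (x : F) (Y : F -> 'cV[C]_n) dY :
  mx_is_derive x Y dY <->
  forall p, is_derive x (1 : F) (fun y => realvec (Y y) p) (realvec dY p).
Proof.
split=> [h [i b]|h i j].
  by have [] := h i 0; rewrite /realvec; case: b.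
by rewrite (ord1 j); split; [exact: (h (i, false))|exact: (h (i, true))].
Qed.

Lemma mxcvgE (G : set_system F) (Y : F -> 'cV[C]_n) L :
  mxcvg G Y L <-> forall p, realvec (Y x) p @[x --> G] --> realvec L p.
Proof.
split=> [h [i b]|h i j].
  by have [] := h i 0; rewrite /realvec; case: b.
by rewrite (ord1 j); split; [exact: (h (i, false))|exact: (h (i, true))].
Qed.

End ComplexReal.

Section ComplexSystem.
Variable F : realType.
Local Notation C := F[i].
Variable n : nat.
Implicit Types (A : F -> 'M[C]_n) (Y : F -> 'cV[C]_n) (P : 'M[C]_n).

Definition real_system A (p q : 'I_n * bool) (x : F) := realmx (A x) p q.
Definition real_curve Y (p : 'I_n * bool) (x : F) := realvec (Y x) p.

(** In dimension 4 this and the next definition are [ode_solution] and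
    [decaying_solution]. *)
Definition csolution A Y := forall x : F, mx_is_derive x Y (A x *m Y x).
Definition cdecaying A (G : set_system F) Y := csolution A Y /\ mxcvg G Y 0.

Lemma csolutionE A Y :
  csolution A Y <-> linear_solution (real_system A) (real_curve Y).
Proof.
split=> [sY p x|sY x].
  by have /mx_is_deriveE/(_ p) := sY x; rewrite realvec_mulmx.
by apply/mx_is_deriveE => p; rewrite realvec_mulmx; exact: sY.
Qed.

Lemma mxcvg0E (G : set_system F) Y :
  mxcvg G Y 0 <-> forall p, real_curve Y p x @[x --> G] --> (0 : F).
Proof.
split=> [/mxcvgE h p|h]; first by have := h p; rewrite realvec0.
by apply/mxcvgE => p; rewrite realvec0; exact: h.
Qed.

Lemma mx_is_derive_mulmx P (x : F) Y dY : mx_is_derive x Y dY ->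
  mx_is_derive x (fun y => P *m Y y) (P *m dY).
Proof.
move=> /mx_is_deriveE h; apply/mx_is_deriveE => p; rewrite realvec_mulmx.
rewrite (_ : (fun y => _) = fun y => \sum_q realmx P p q * realvec (Y y) q); last first.
  by apply/funext => y; rewrite realvec_mulmx.
by apply: is_derive_finsum => q; have := h q => ?; exact: is_deriveZ.
Qed.

Lemma mxcvg0_mulmx P (G : set_system F) (FG : Filter G) Y : mxcvg G Y 0 ->
  mxcvg G (fun y => P *m Y y) 0.
Proof.
move=> /mxcvg0E h; apply/mxcvg0E => p;
rewrite (_ : real_curve _ p = fun y => \sum_q realmx P p q * realvec (Y y) q); last first.
  by apply/funext => y; rewrite /real_curve realvec_mulmx.
rewrite [X in _ --> X](_ : 0 = \sum_q realmx P p q * 0); last first.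
  by rewrite big1// => q _; rewrite mulr0.
apply: cvg_big => [|q _]; first exact: add_continuous.
by apply: cvgMr; exact: h.
Qed.

Lemma cdecaying_conj A B P (G : set_system F) (FG : Filter G) Y :
  (forall x, P *m A x = B x *m P) ->
  cdecaying A G Y -> cdecaying B G (fun x => P *m Y x).
Proof.
move=> PAB [sY dY]; split; last exact: mxcvg0_mulmx.
by move=> x; rewrite mulmxA -PAB -mulmxA; exact: mx_is_derive_mulmx.
Qed.

Lemma cdecayingD A (G : set_system F) (FG : Filter G) Y Z :
  cdecaying A G Y -> cdecaying A G Z -> cdecaying A G (fun x => Y x + Z x).
Proof.
move=> [sY dY] [sZ dZ]; split.
  move=> x; apply/mx_is_deriveE => p.
  rewrite mulmxDr realvecD (_ : (fun y => _) = (fun y => realvec (Y y) p + realvec (Z y) p)).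
    have /mx_is_deriveE/(_ p) h1 := sY x; have /mx_is_deriveE/(_ p) h2 := sZ x.
    exact: is_deriveD.
  by apply/funext => y; rewrite realvecD.
apply/mxcvg0E => p;
rewrite (_ : real_curve _ p = fun y => realvec (Y y) p + realvec (Z y) p); last first.
  by apply/funext => y; rewrite /real_curve realvecD.
rewrite -[X in _ --> X](addr0 0).
by apply: cvgD; [move/mxcvg0E : dY => /(_ p)|move/mxcvg0E : dZ => /(_ p)].
Qed.

Lemma cdecayingZ A (G : set_system F) (FG : Filter G) (a : C) Y :
  cdecaying A G Y -> cdecaying A G (fun x => a *: Y x).
Proof.
move=> dY; under eq_fun do rewrite -mul_scalar_mx.
by apply: cdecaying_conj dY => x; rewrite scalar_mxC.
Qed.

Section Diagonalized.
Variables (A B : F -> 'M[C]_n) (P : 'M[C]_n) (M c : F) (sg : pred 'I_n).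
Let sgp : pred ('I_n * bool) := fun p => sg p.1.
Hypothesis cB : forall p q, continuous (real_system B p q).
Hypothesis bB : forall p q (x : F), `|real_system B p q x| <= M.
Hypothesis c0 : 0 < c.
Hypothesis dich : dichotomy (real_system B) sgp c.
Hypothesis Pu : P \in unitmx.
Hypothesis PAB : forall x, P *m A x = B x *m P.

Lemma conj_invmx x : invmx P *m B x = A x *m invmx P.
Proof. by rewrite -[B x](mulmxK Pu) -PAB !mulmxA mulVmx// mul1mx. Qed.

Lemma cdecaying_exists_pinfty (zeta : 'cV[C]_n) : exists Y,
  cdecaying A +oo Y /\ forall i, ~~ sg i -> (P *m Y 0) i 0 = zeta i 0.
Proof.
have [Y [sY Y0 dY]] := decaying_solution_exists cB bB c0 dich (realvec zeta).
have dZ : cdecaying B +oo (fun x => cplxvec (Y^~ x)).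
  have RY : real_curve (fun x => cplxvec (Y^~ x)) = Y.
    by apply/funext => p; apply/funext => x; rewrite /real_curve cplxvecK.
  by split; [apply/csolutionE|apply/mxcvg0E => p]; rewrite RY.
exists (fun x => invmx P *m cplxvec (Y^~ x)); split.
  exact: (cdecaying_conj _ conj_invmx dZ).
move=> i si; rewrite mulKVmx// mxE !Y0//= /realvec/=.
by case: (zeta i 0).
Qed.

Lemma cdecaying_exists_ninfty (zeta : 'cV[C]_n) : exists Y,
  cdecaying A -oo Y /\ forall i, sg i -> (P *m Y 0) i 0 = zeta i 0.
Proof.
have [Y [sY Y0 dY]] := decaying_solution_exists_ninfty cB bB c0 dich (realvec zeta).
have dZ : cdecaying B -oo (fun x => cplxvec (Y^~ x)).
  have RY : real_curve (fun x => cplxvec (Y^~ x)) = Y.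
    by apply/funext => p; apply/funext => x; rewrite /real_curve cplxvecK.
  by split; [apply/csolutionE|apply/mxcvg0E => p]; rewrite RY.
exists (fun x => invmx P *m cplxvec (Y^~ x)); split.
  exact: (cdecaying_conj _ conj_invmx dZ).
move=> i si; rewrite mulKVmx// mxE !Y0//= /realvec/=.
by case: (zeta i 0).
Qed.

Lemma real_curve_conj_eq0 Y : (forall p x, real_curve (fun x => P *m Y x) p x = 0) ->
  forall x, Y x = 0.
Proof.
move=> h x; rewrite -[Y x](mulKmx Pu) (@realvec_eq0 _ _ (P *m Y x)) ?mulmx0// => p.
exact: h.
Qed.

Lemma cdecaying_eq0_pinfty Y : cdecaying A +oo Y ->
  (forall i, ~~ sg i -> (P *m Y 0) i 0 = 0) -> forall x, Y x = 0.
Proof.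
move=> /(cdecaying_conj _ PAB)[/csolutionE sY /mxcvg0E dY] Y0.
apply: real_curve_conj_eq0.
apply: (decaying_eq0_pinfty bB c0 dich sY dY) => -[i b]/= si.
by rewrite /real_curve /realvec/= Y0// if_same.
Qed.

Lemma cdecaying_eq0_ninfty Y : cdecaying A -oo Y ->
  (forall i, sg i -> (P *m Y 0) i 0 = 0) -> forall x, Y x = 0.
Proof.
move=> /(cdecaying_conj _ PAB)[/csolutionE sY /mxcvg0E dY] Y0.
apply: real_curve_conj_eq0.
apply: (decaying_eq0_ninfty bB c0 dich sY dY) => -[i b]/= si.
by rewrite /real_curve /realvec/= Y0// if_same.
Qed.

Lemma cdecaying_both_eq0 V W : cdecaying A -oo V -> cdecaying A +oo W ->
  V 0 = W 0 -> (forall x, V x = 0) /\ (forall x, W x = 0).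
Proof.
move=> dV dW VW.
have V0 : P *m V 0 = 0.
  move: (dV) (dW) => /(cdecaying_conj _ PAB)[/csolutionE sV /mxcvg0E cV]
    /(cdecaying_conj _ PAB)[/csolutionE sW /mxcvg0E cW].
  apply: realvec_eq0; apply: (decaying_both_eq0 c0 dich sV sW cV cW) => p.
  by rewrite /real_curve VW.
split; [apply: cdecaying_eq0_ninfty => //|apply: cdecaying_eq0_pinfty => //] => i _.
  by rewrite V0 mxE.
by rewrite -VW V0 mxE.
Qed.

End Diagonalized.

End ComplexSystem.


(** * The Evans determinant of a split system *)

Section EvansSystem.
Variable F : realType.
Local Notation C := F[i].
Variables (A B : F -> 'M[C]_4) (P : 'M[C]_4) (M c : F).
Let sg : pred 'I_4 := fun i => ~~ odd i.
Hypothesis cB : forall p q, continuous (real_system B p q).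
Hypothesis bB : forall p q (x : F), `|real_system B p q x| <= M.
Hypothesis c0 : 0 < c.
Hypothesis dich : dichotomy (real_system B) (fun p => sg p.1) c.
Hypothesis Pu : P \in unitmx.
Hypothesis PAB : forall x, P *m A x = B x *m P.

(** The basis consists of the solutions with coordinates (1, 0) and (0, 1);
    the coefficients of any other one are its own coordinates. *)
Lemma decaying_basis_of_coordinates (G : set_system F) (FG : Filter G) (i1 i2 : 'I_4) :
  i1 != i2 ->
  (forall zeta : 'cV[C]_4, exists Y,
    cdecaying A G Y /\ forall i, i \in [:: i1; i2] -> (P *m Y 0) i 0 = zeta i 0) ->
  (forall Y, cdecaying A G Y ->
    (forall i, i \in [:: i1; i2] -> (P *m Y 0) i 0 = 0) -> forall x, Y x = 0) ->
  exists Y1 Y2, decaying_basis A G Y1 Y2.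
Proof.
move=> i12 ex uniq.
have [Y1 [d1 e1]] := ex (delta_mx i1 0).
have [Y2 [d2 e2]] := ex (delta_mx i2 0).
have coord (c1 c2 : C) (i : 'I_4) : i \in [:: i1; i2] ->
    (P *m (c1 *: Y1 0 + c2 *: Y2 0)) i 0 = if i == i1 then c1 else c2.
  move=> ii; rewrite mulmxDr -!scalemxAr !mxE.
  have := e1 _ ii; have := e2 _ ii; rewrite !mxE !eqxx !andbT => -> ->.
  move: ii; rewrite !inE => /orP[] /eqP ->.
    by rewrite eqxx (negPf i12) mulr0 mulr1 addr0.
  by rewrite eqxx eq_sym (negPf i12) mulr0 mulr1 add0r.
exists Y1, Y2; split => //.
  move=> c1 c2 /(_ 0) h.
  have h1 := coord c1 c2 i1 (mem_head _ _).
  have h2 : (P *m (c1 *: Y1 0 + c2 *: Y2 0)) i2 0 = if i2 == i1 then c1 else c2.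
    by apply: coord; rewrite !inE eqxx orbT.
  move: h1 h2; rewrite h mulmx0 !mxE eqxx eq_sym (negPf i12).
  by move=> -> ->.
move=> Y dY; exists ((P *m Y 0) i1 0), ((P *m Y 0) i2 0) => x.
set a1 := (P *m Y 0) i1 0; set a2 := (P *m Y 0) i2 0.
have dS := cdecayingD FG (cdecayingZ FG a1 d1) (cdecayingZ FG a2 d2).
have dD := cdecayingD FG dY (cdecayingZ FG (- 1) dS).
apply/eqP; rewrite -subr_eq0 -scaleN1r; apply/eqP.
apply: (uniq _ dD) => i ii; rewrite mulmxDr -scalemxAr.
rewrite mxE [(_ *: (_ : matrix _ _ _)) _ _]mxE coord// mulN1r.
apply/eqP; rewrite subr_eq0; apply/eqP.
by move: ii; rewrite !inE => /orP[] /eqP ->; rewrite ?eqxx// eq_sym (negPf i12).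
Qed.

Lemma odd_ord4 (i : 'I_4) : (odd i) = (i \in [:: inord 1; inord 3]).
Proof. by rewrite !inE -!val_eqE/= !inordK//; case: i => -[|[|[|[|]]]]. Qed.

Lemma even_ord4 (i : 'I_4) : (~~ odd i) = (i \in [:: inord 0; inord 2]).
Proof. by rewrite !inE -!val_eqE/= !inordK//; case: i => -[|[|[|[|]]]]. Qed.

Lemma decaying_basis_pinfty : exists Y1 Y2, decaying_basis A +oo Y1 Y2.
Proof.
apply: (@decaying_basis_of_coordinates _ _ (inord 1) (inord 3)).
- by rewrite -val_eqE/= !inordK.
- move=> zeta; have [Y [dY Y0]] := cdecaying_exists_pinfty cB bB c0 dich Pu PAB zeta.
  by exists Y; split=> // i; rewrite -odd_ord4 => oi; apply: Y0; rewrite negbK.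
- move=> Y dY h; apply: (cdecaying_eq0_pinfty (sg := sg) bB c0 dich Pu PAB dY) => i.
  by rewrite negbK odd_ord4; exact: h.
Qed.

Lemma decaying_basis_ninfty : exists Y1 Y2, decaying_basis A -oo Y1 Y2.
Proof.
apply: (@decaying_basis_of_coordinates _ _ (inord 0) (inord 2)).
- by rewrite -val_eqE/= !inordK.
- move=> zeta; have [Y [dY Y0]] := cdecaying_exists_ninfty cB bB c0 dich Pu PAB zeta.
  by exists Y; split=> // i; rewrite -even_ord4 => oi; apply: Y0.
- move=> Y dY h; apply: (cdecaying_eq0_ninfty (sg := sg) bB c0 dich Pu PAB dY) => i.
  by rewrite /sg even_ord4; exact: h.
Qed.

(** A linear relation between the four columns equates a combination of
    solutions decaying at -oo with one of solutions decaying at +oo, at 0;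
    both are then identically zero, and so are their coefficients. *)
Lemma evans_nonzero_of_split : split_at A -oo -> split_at A +oo -> evans_nonzero A.
Proof.
move=> sm sp; split.
  split => //.
  have [Ym1 [Ym2 hm]] := decaying_basis_ninfty.
  have [Yp1 [Yp2 hp]] := decaying_basis_pinfty.
  by eexists; exists Ym1, Ym2, Yp1, Yp2; split.
move=> e [Ym1 [Ym2 [Yp1 [Yp2 [[dm1 dm2 im _] [dp1 dp2 ip _] ->]]]]].
apply/eqP/negP => /eqP det0.
set Q := row_mx _ _ in det0.
have /eqP/det0P[d d0 dQ] : \det Q^T = 0 by rewrite det_tr.
have {}dQ : Q *m d^T = 0.
  by apply: trmx_inj; rewrite trmx_mul trmxK trmx0.
pose dd : 'cV[C]_(1 + 1 + (1 + 1)) := d^T.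
pose d1 := usubmx (usubmx dd) 0 0; pose d2 := dsubmx (usubmx dd) 0 0.
pose d3 := usubmx (dsubmx dd) 0 0; pose d4 := dsubmx (dsubmx dd) 0 0.
have mulc (y : 'cV[C]_4) (w : 'cV[C]_1) : y *m w = w 0 0 *: y.
  by rewrite [w]mx11_scalar mul_mx_scalar mxE eqxx mulr1n.
have QE : d1 *: Ym1 0 + d2 *: Ym2 0 + (d3 *: Yp1 0 + d4 *: Yp2 0) = 0.
  rewrite -[RHS]dQ -[d^T]/dd -[dd]vsubmxK mul_row_col.
  rewrite -[usubmx dd]vsubmxK -[dsubmx dd]vsubmxK !mul_row_col.
  by rewrite !mulc.
have dV := cdecayingD _ (cdecayingZ _ d1 dm1) (cdecayingZ _ d2 dm2).
have dW := cdecayingZ _ (-1) (cdecayingD _ (cdecayingZ _ d3 dp1) (cdecayingZ _ d4 dp2)).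
have VW : d1 *: Ym1 0 + d2 *: Ym2 0 = -1 *: (d3 *: Yp1 0 + d4 *: Yp2 0).
  by apply/eqP; rewrite scaleN1r -addr_eq0; apply/eqP.
have [V0 W0] := cdecaying_both_eq0 bB c0 dich Pu PAB (dV _ _ _) (dW _ _ _ _) VW.
have [d10 d20] := im _ _ V0.
have [d30 d40] : d3 = 0 /\ d4 = 0.
  apply: ip => x; have := W0 x.
  by rewrite scaleN1r => /eqP; rewrite oppr_eq0 => /eqP.
move/negP: d0; apply; apply/eqP; apply: trmx_inj; rewrite trmx0 -[d^T]/dd.
rewrite -[dd]vsubmxK -[usubmx dd]vsubmxK -[dsubmx dd]vsubmxK.
rewrite [usubmx (usubmx dd)]mx11_scalar [dsubmx (usubmx dd)]mx11_scalar.
rewrite [usubmx (dsubmx dd)]mx11_scalar [dsubmx (dsubmx dd)]mx11_scalar.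
rewrite -/d1 -/d2 -/d3 -/d4 d10 d20 d30 d40.
by rewrite !raddf0 !col_mx0.
Qed.

End EvansSystem.

(** * Smooth functions with limits at both ends *)

Section Tame.
Variable F : realType.
Implicit Types (f g : F -> F).

Definition asymptotic f := continuous f /\
  exists lm lp : F, f x @[x --> -oo] --> lm /\ f x @[x --> +oo] --> lp.

(** Derivatives are included up to order n, so that closure under products,
    powers and differentiation can be proved by induction on n. *)
Fixpoint tame n f := asymptotic f /\
  if n is m.+1 then (forall x : F, derivable f x 1) /\ tame m (derive1 f) else True.

Definition smooth_tame f := forall n, tame n f.

Lemma tame_asymptotic n f : tame n f -> asymptotic f.
Proof. by case: n => [|n] []. Qed.

Lemma tameW n f : tame n.+1 f -> tame n f.
Proof. by elim: n f => [|n IH] f [af [df tf]]; split => //; split => //; exact: IH. Qed.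

Lemma asymptoticD f g : asymptotic f -> asymptotic g -> asymptotic (fun x => f x + g x).
Proof.
move=> [cf [fm [fp [hfm hfp]]]] [cg [gm [gp [hgm hgp]]]]; split.
  by move=> x; apply: cvgD; [exact: cf|exact: cg].
by exists (fm + gm), (fp + gp); split; apply: cvgD.
Qed.

Lemma asymptoticM f g : asymptotic f -> asymptotic g -> asymptotic (fun x => f x * g x).
Proof.
move=> [cf [fm [fp [hfm hfp]]]] [cg [gm [gp [hgm hgp]]]]; split.
  by move=> x; apply: cvgM; [exact: cf|exact: cg].
by exists (fm * gm), (fp * gp); split; apply: cvgM.
Qed.

Lemma asymptotic_cst (a : F) : asymptotic (fun=> a).
Proof.
split; first exact: cst_continuous.
by exists a, a; split; exact: cvg_cst.
Qed.

Lemma tame_cst n (a : F) : tame n (fun=> a).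
Proof.
elim: n a => [|n IH] a; split => //; [exact: asymptotic_cst|exact: asymptotic_cst|].
split; first by move=> x; exact: derivable_cst.
by rewrite (_ : derive1 _ = fun=> 0)//; apply/funext => x; rewrite derive1_cst.
Qed.

Lemma tameD n f g : tame n f -> tame n g -> tame n (fun x => f x + g x).
Proof.
elim: n f g => [|n IH] f g.
  by move=> [af _] [ag _]; split => //; exact: asymptoticD.
move=> [af [df tf]] [ag [dg tg]]; split; [exact: asymptoticD|split].
  by move=> x; apply: derivableD.
rewrite (_ : derive1 _ = fun x => derive1 f x + derive1 g x); first exact: IH.
by apply/funext => x; rewrite !derive1E deriveD.
Qed.

Lemma tameM n f g : tame n f -> tame n g -> tame n (fun x => f x * g x).
Proof.
elim: n f g => [|n IH] f g.
  by move=> [af _] [ag _]; split => //; exact: asymptoticM.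
move=> tf tg; move: (tf) (tg) => [af [df tf']] [ag [dg tg']]; split; [exact: asymptoticM|split].
  by move=> x; apply: derivableM.
rewrite (_ : derive1 _ = fun x => f x * derive1 g x + g x * derive1 f x).
  by apply: tameD; apply: IH => //; exact: tameW.
by apply/funext => x; rewrite !derive1E deriveM.
Qed.

Lemma smooth_tameD f g : smooth_tame f -> smooth_tame g -> smooth_tame (fun x => f x + g x).
Proof. by move=> tf tg n; exact: tameD. Qed.

Lemma smooth_tameM f g : smooth_tame f -> smooth_tame g -> smooth_tame (fun x => f x * g x).
Proof. by move=> tf tg n; exact: tameM. Qed.

Lemma smooth_tame_cst (a : F) : smooth_tame (fun=> a).
Proof. by move=> n; exact: tame_cst. Qed.

Lemma smooth_tameN f : smooth_tame f -> smooth_tame (fun x => - f x).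
Proof.
move=> tf; rewrite (_ : (fun x => _) = fun x => -1 * f x).
  by apply: smooth_tameM => //; exact: smooth_tame_cst.
by apply/funext => x; rewrite mulN1r.
Qed.

Lemma smooth_tame_derive1 f : smooth_tame f -> smooth_tame (derive1 f).
Proof. by move=> tf n; have [_ []] := tf n.+1. Qed.

Lemma smooth_tame_derive1n f k : smooth_tame f -> smooth_tame (derive1n k f).
Proof. by move=> tf; elim: k => [|k IH]//; rewrite derive1nS; exact: smooth_tame_derive1. Qed.

Definition positive_asymptotic f := (forall x, 0 < f x) /\
  exists lm lp : F, [/\ 0 < lm, 0 < lp, f x @[x --> -oo] --> lm & f x @[x --> +oo] --> lp].

(** By induction on the order for all exponents at once, since the
    derivative of f^a is a f^(a-1) f'. *)
Lemma tame_powR n f (a : F) : positive_asymptotic f -> smooth_tame f ->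
  tame n (fun x => f x `^ a).
Proof.
move=> pf tf; have [f0 [lm [lp [lm0 lp0 hm hp]]]] := pf.
have dpow (y b : F) : 0 < y -> is_derive y (1 : F) (fun z : F => z `^ b) (b * y `^ (b - 1)).
  by move=> y0; exact: is_derive1_powR.
have cpow (y b : F) : 0 < y -> {for y, continuous (fun z : F => z `^ b)}.
  move=> y0; have [d _] := dpow y b y0.
  exact/differentiable_continuous/derivable1_diffP.
have [_ [df _]] := tf 1%N.
have cf x : {for x, continuous f} by apply/differentiable_continuous/derivable1_diffP.
have asy b : asymptotic (fun x => f x `^ b).
  split; first by move=> x; exact: (cvg_comp _ _ (cf x) (cpow _ b (f0 x))).
  exists (lm `^ b), (lp `^ b); split.
    exact: (cvg_comp _ _ hm (cpow _ b lm0)).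
  exact: (cvg_comp _ _ hp (cpow _ b lp0)).
elim: n a => [|n IH] a; split => //.
have dfa x : is_derive x (1 : F) (fun x => f x `^ a) (a * f x `^ (a - 1) * derive1 f x).
  apply: (@is_derive1_comp F (fun z => z `^ a) f); first exact: dpow.
  by rewrite derive1E; apply: DeriveDef.
split; first by move=> x; have [] := dfa x.
rewrite (_ : derive1 _ = fun x => a * f x `^ (a - 1) * derive1 f x).
  apply: tameM; last exact: smooth_tame_derive1.
  by apply: tameM; [exact: tame_cst|exact: IH].
by apply/funext => x; rewrite derive1E; have [_ ->] := dfa x.
Qed.

Lemma smooth_tame_powR f (a : F) : positive_asymptotic f -> smooth_tame f ->
  smooth_tame (fun x => f x `^ a).
Proof. by move=> pf tf n; exact: tame_powR. Qed.

Lemma smooth_tameV f : positive_asymptotic f -> smooth_tame f ->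
  smooth_tame (fun x => (f x)^-1).
Proof.
move=> pf tf; rewrite (_ : (fun x => _) = fun x => f x `^ (-1)).
  exact: smooth_tame_powR.
by apply/funext => x; rewrite powR_inv1//; have [/(_ x)/ltW] := pf.
Qed.

Lemma positive_asymptotic_sqr f : positive_asymptotic f ->
  positive_asymptotic (fun x => f x ^+ 2).
Proof.
move=> [f0 [lm [lp [lm0 lp0 hm hp]]]]; split; first by move=> x; rewrite exprn_gt0.
exists (lm * lm), (lp * lp); split; [exact: mulr_gt0|exact: mulr_gt0| |].
  exact: (cvgM hm hm).
exact: (cvgM hp hp).
Qed.

Lemma smooth_tame_of_smooth f : smooth f ->
  (exists lm lp : F, f x @[x --> -oo] --> lm /\ f x @[x --> +oo] --> lp) ->
  (forall n, (0 < n)%N -> derive1n n f x @[x --> -oo] --> (0 : F) /\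
     derive1n n f x @[x --> +oo] --> (0 : F)) -> smooth_tame f.
Proof.
move=> sf lf ldf.
suff h n k : tame n (derive1n k f) by move=> n; exact: (h n 0%N).
have asy k' : asymptotic (derive1n k' f).
  split; first by move=> x; apply/differentiable_continuous/derivable1_diffP; exact: sf.
  by case: k' => [|k']//; exists 0, 0; exact: (ldf k'.+1).
by elim: n k => [|n IH] k; split => //; split; [exact: sf|rewrite -derive1nS; exact: IH].
Qed.

(** The limits bound the function near both ends, the extreme value theorem
    bounds it in between. *)
Lemma asymptotic_bounded f : asymptotic f -> exists M, forall x, `|f x| <= M.
Proof.
move=> [cf [lm [lp [hm hp]]]].
have [N1 [_ h1]] : \forall x \near -oo, `|lm - f x| < 1 by exact: cvgr_dist_lt.
have [N2 [_ h2]] : \forall x \near +oo, `|lp - f x| < 1 by exact: cvgr_dist_lt.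
pose N := `|N1| + `|N2| + 1.
have N0 : 0 <= N by rewrite !addr_ge0.
have NN : - N <= N by rewrite ge0_cp.
have [c _ hc] : exists2 c, c \in `[- N, N]%R &
    forall t, t \in `[- N, N]%R -> `|f t| <= `|f c|.
  apply: (@EVT_max F (fun x => `|f x|) _ _ NN); apply: continuous_subspaceT => x.
  by apply: cvg_norm; exact: cf.
exists (`|f c| + `|lm| + `|lp| + 1) => x.
have [xN|xN] := ltP x (- N).
  have : `|lm - f x| < 1.
    apply: h1; move: xN; rewrite /N; have := ler_norm (- N1); rewrite normrN.
    have := normr_ge0 N2; lra.
  have := ler_normB lm (lm - f x); rewrite opprB addrC subrK.
  have := normr_ge0 (f c); have := normr_ge0 lp; lra.
have [Nx|Nx] := ltP N x.
  have : `|lp - f x| < 1.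
    apply: h2; move: Nx; rewrite /N; have := ler_norm N2.
    have := normr_ge0 N1; lra.
  have := ler_normB lp (lp - f x); rewrite opprB addrC subrK.
  have := normr_ge0 (f c); have := normr_ge0 lm; lra.
have : `|f x| <= `|f c| by apply: hc; rewrite in_itv /= xN Nx.
have := normr_ge0 lp; have := normr_ge0 lm; lra.
Qed.

End Tame.

(** * Regularity of the coefficients *)

Section Coefficients.
Variables (F : realType) (gamma mu k s : F) (R U : F -> F).
Hypothesis hprofile : is_profile gamma mu k s R U.

Lemma profile_positive : positive_asymptotic R.
Proof. by split; [exact: profile_gt0 hprofile|exact: profile_cvgR hprofile]. Qed.

Lemma profile_tameR : smooth_tame R.
Proof.
apply: smooth_tame_of_smooth; first exact: profile_smoothR hprofile.
  by have [lm [lp [_ _ h1 h2]]] := profile_cvgR hprofile; exists lm, lp.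
exact: profile_derivR hprofile.
Qed.

Lemma profile_tameU : smooth_tame U.
Proof.
apply: smooth_tame_of_smooth; first exact: profile_smoothU hprofile.
  exact: profile_cvgU hprofile.
exact: profile_derivU hprofile.
Qed.

(** For gamma = 1 the enthalpy is the logarithm, whose derivative is still
    the power gamma - 2 of the density. *)
Lemma f1E : f1 gamma R = fun x => - (gamma * R x `^ (gamma - 2)).
Proof.
apply/funext => x; rewrite /f1; congr (- _).
have Rx : 0 < R x by exact: profile_gt0 hprofile x.
rewrite derive1E.
have [g1|g1] := eqVneq gamma 1.
  rewrite (_ : enthalpy gamma = @ln F); last first.
    by apply/funext => y; rewrite /enthalpy g1 eqxx.
  have [_ ->] := is_derive1_ln Rx.
  by rewrite g1 mul1r (_ : 1 - 2 = -1) ?powR_inv1// ?ltW//; ring.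
rewrite (_ : enthalpy gamma = fun y => gamma / (gamma - 1) * y `^ (gamma - 1)); last first.
  by apply/funext => y; rewrite /enthalpy (negPf g1).
have dp := is_derive1_powR (gamma - 1) Rx.
have [_ ->] := is_deriveZ (gamma / (gamma - 1)) dp.
rewrite /GRing.scale /= mulrA divfK ?subr_eq0//.
by rewrite (_ : gamma - 1 - 1 = gamma - 2)//; ring.
Qed.

Ltac tame := repeat first
  [ exact: profile_tameR | exact: profile_tameU | exact: profile_positive
  | exact: (positive_asymptotic_sqr profile_positive)
  | exact: smooth_tame_cst
  | apply: smooth_tame_derive1n | apply: smooth_tame_derive1
  | apply: smooth_tameD | apply: smooth_tameN | apply: smooth_tameM
  | apply: smooth_tameV | apply: smooth_tame_powR ].

Lemma tame_f1 : smooth_tame (f1 gamma R).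
Proof. rewrite f1E; tame. Qed.

Lemma tame_f2 : smooth_tame (f2 s U).
Proof. rewrite /f2; tame. Qed.

Lemma tame_f6 : smooth_tame (f6 s R U).
Proof. rewrite /f6; tame. Qed.

Lemma tame_Rinv : smooth_tame (Rinv R).
Proof. rewrite /Rinv; tame. Qed.

Lemma tame_Rpow (a : F) : smooth_tame (Rpow R a).
Proof. rewrite /Rpow; tame. Qed.

Lemma tame_g1 : smooth_tame (g1 mu R).
Proof. rewrite /g1; tame. Qed.

Lemma tame_g2 : smooth_tame (g2 mu R).
Proof. rewrite /g2; tame. Qed.

Lemma tame_g3 : smooth_tame (g3 mu R U).
Proof. rewrite /g3; tame. Qed.

Lemma tame_g4 : smooth_tame (g4 mu R U).
Proof. rewrite /g4; tame. Qed.

Lemma tame_f3 : smooth_tame (f3 k R).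
Proof. have := tame_Rpow => tp; rewrite /f3; repeat first [exact: tp|progress tame]. Qed.

Lemma tame_f4 : smooth_tame (f4 k R).
Proof. have := tame_Rpow => tp; rewrite /f4; repeat first [exact: tp|progress tame]. Qed.

(** The auxiliary functions are replaced by variables, so that unification
    only traverses the outer algebra of an expression and never unfolds
    them. *)
Ltac abstract_coefficients :=
  have := profile_tameR; have := profile_tameU; have := profile_positive;
  have := tame_f1; have := tame_f2; have := tame_f3; have := tame_f4; have := tame_f6;
  have := tame_g1; have := tame_g2; have := tame_g3; have := tame_g4; have := tame_Rinv;
  move: (f1 gamma R) (f2 s U) (f3 k R) (f4 k R) (f6 s R U) (g1 mu R) (g2 mu R)
    (g3 mu R U) (g4 mu R U) (Rinv R) R U;
  clear; intros;
  repeat first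
  [ assumption | apply: smooth_tame_cst
  | apply: smooth_tame_derive1n | apply: smooth_tame_derive1
  | apply: smooth_tameD | apply: smooth_tameN | apply: smooth_tameM
  | apply: smooth_tameV ].

Lemma tame_E_rho : smooth_tame (E_rho mu s R U).
Proof. rewrite /E_rho; abstract_coefficients. Qed.

Lemma tame_E_drho : smooth_tame (E_drho gamma mu k s R U).
Proof. rewrite /E_drho; abstract_coefficients. Qed.

Lemma tame_E_drho_lambda : smooth_tame (E_drho_lambda mu s R U).
Proof. rewrite /E_drho_lambda; abstract_coefficients. Qed.

Lemma tame_E_d2rho : smooth_tame (E_d2rho gamma mu k s R U).
Proof. rewrite /E_d2rho; abstract_coefficients. Qed.

Lemma tame_E_d3rho : smooth_tame (E_d3rho mu k s R).
Proof. rewrite /E_d3rho; abstract_coefficients. Qed.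

End Coefficients.

(** * Modulus and limits of complex numbers *)

Local Open Scope complex_scope.
Local Arguments cabs : simpl never.



Section ComplexModulus.
Variable F : realType.
Local Notation C := F[i].
Local Notation Re := complex.Re.
Local Notation Im := complex.Im.
Implicit Types (x y z : C).

Lemma cabs_ge0 z : 0 <= cabs z.
Proof. by case: z => ? ?; exact: sqrtr_ge0. Qed.

Lemma cabs_sqr z : cabs z ^+ 2 = Re z ^+ 2 + Im z ^+ 2.
Proof. by case: z => u v; rewrite /cabs/= sqr_sqrtr// addr_ge0// sqr_ge0. Qed.

Lemma cabsM x y : cabs (x * y) = cabs x * cabs y.
Proof. exact: ComplexField.Normc.normcM. Qed.

Lemma cabsV x : cabs x^-1 = (cabs x)^-1.
Proof. exact: ComplexField.Normc.normcV. Qed.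

Lemma cabs0 : cabs (0 : C) = 0.
Proof. exact: ComplexField.Normc.normc0. Qed.

Lemma cabsR (u : F) : cabs u%:C = `|u|.
Proof. by rewrite /cabs/= expr0n addr0 sqrtr_sqr. Qed.

Lemma cabsD x y : cabs (x + y) <= cabs x + cabs y.
Proof. exact: le_normcD. Qed.

Lemma cabsN x : cabs (- x) = cabs x.
Proof. exact: normcN. Qed.

Lemma cabsX x n : cabs (x ^+ n) = cabs x ^+ n.
Proof.
elim: n => [|n IH]; last by rewrite !exprS cabsM IH.
by rewrite !expr0; exact: ComplexField.Normc.normc1.
Qed.

Lemma cabs_eq0 x : (cabs x == 0) = (x == 0).
Proof.
apply/eqP/eqP => [/ComplexField.Normc.eq0_normc//|->]; exact: cabs0.
Qed.

Lemma cabs_sum (J : Type) (r : seq J) (f : J -> C) :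
  cabs (\sum_(j <- r) f j) <= \sum_(j <- r) cabs (f j).
Proof.
elim: r => [|j r IH]; first by rewrite !big_nil cabs0.
by rewrite !big_cons; apply: le_trans (cabsD _ _) _; rewrite lerD2l.
Qed.

Lemma Re_le_cabs z : `|Re z| <= cabs z.
Proof.
rewrite -(@ler_pXn2r _ 2)// ?nnegrE ?cabs_ge0// real_normK ?num_real// cabs_sqr.
by rewrite lerDl sqr_ge0.
Qed.

Lemma Im_le_cabs z : `|Im z| <= cabs z.
Proof.
rewrite -(@ler_pXn2r _ 2)// ?nnegrE ?cabs_ge0// real_normK ?num_real// cabs_sqr.
by rewrite lerDr sqr_ge0.
Qed.

(** Cauchy-Schwarz inequality for the real scalar product of two complex
    numbers. *)
Lemma re_dot_le x y : Re x * Re y + Im x * Im y <= cabs x * cabs y.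
Proof.
have -> : Re x * Re y + Im x * Im y = Re (x * y^*).
  by case: x y => ? ? [] ? ?; rewrite ReM/=; ring.
apply: le_trans (ler_norm _) _; apply: le_trans (Re_le_cabs _) _.
rewrite cabsM (_ : cabs y^* = cabs y)//.
by case: y => u v; rewrite /cabs/= sqrrN.
Qed.

Lemma re_dot_mode z x y (t : F) :
  Re z * Re (x * t%:C * z - y) + Im z * Im (x * t%:C * z - y) =
  t * Re x * cabs z ^+ 2 - (Re z * Re y + Im z * Im y).
Proof. by rewrite cabs_sqr; case: z x y => u v [c d] [u' v'] /=; ring. Qed.

Lemma re_dotN x y : Re x * Re (- y) + Im x * Im (- y) = - (Re x * Re y + Im x * Im y).
Proof. by case: x y => u v [u' v'] /=; ring. Qed.

Definition ccvg (G : set_system F) (h : F -> C) (l : C) :=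
  Re (h x) @[x --> G] --> Re l /\ Im (h x) @[x --> G] --> Im l.

Lemma ccvg_cst (G : set_system F) (FG : Filter G) (l : C) : ccvg G (fun=> l) l.
Proof. by split; exact: cvg_cst. Qed.

Lemma ccvgD (G : set_system F) (FG : Filter G) (h g : F -> C) (l l' : C) :
  ccvg G h l -> ccvg G g l' -> ccvg G (fun x : F => h x + g x) (l + l').
Proof.
move=> [h1 h2] [g1 g2]; split; rewrite ?ReD ?ImD.
  by under eq_cvg do rewrite ReD; exact: cvgD.
by under eq_cvg do rewrite ImD; exact: cvgD.
Qed.

Lemma ccvgM (G : set_system F) (FG : Filter G) (h g : F -> C) (l l' : C) :
  ccvg G h l -> ccvg G g l' -> ccvg G (fun x : F => h x * g x) (l * l').
Proof.
move=> [h1 h2] [g1 g2]; split; rewrite ?ReM ?ImM.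
  by under eq_cvg do rewrite ReM; apply: cvgB; exact: cvgM.
by under eq_cvg do rewrite ImM; apply: cvgD; exact: cvgM.
Qed.

Lemma ccvgN (G : set_system F) (FG : Filter G) (h : F -> C) (l : C) :
  ccvg G h l -> ccvg G (fun x : F => - h x) (- l).
Proof.
move=> hl; rewrite -mulN1r (_ : (fun x : F => _) = fun x : F => -1 * h x).
  exact: (ccvgM _ (ccvg_cst _ _)).
by apply/funext => x; rewrite mulN1r.
Qed.

Lemma ccvgR (G : set_system F) (FG : Filter G) (f : F -> F) (l : F) :
  f x @[x --> G] --> l -> ccvg G (fun x : F => (f x)%:C) l%:C.
Proof. by move=> fl; split => //; exact: cvg_cst. Qed.

Lemma ccvg_sum (G : set_system F) (FG : Filter G) (J : Type) (r : seq J)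
    (h : J -> F -> C) (l : J -> C) :
  (forall j, ccvg G (h j) (l j)) ->
  ccvg G (fun x : F => \sum_(j <- r) h j x) (\sum_(j <- r) l j).
Proof.
move=> hl; elim: r => [|j r IH].
  rewrite big_nil (_ : (fun x : F => _) = fun=> 0); first exact: ccvg_cst.
  by apply/funext => x; rewrite big_nil.
rewrite big_cons (_ : (fun x : F => _) =
  fun x : F => h j x + \sum_(j <- r) h j x); first exact: ccvgD.
by apply/funext => x; rewrite big_cons.
Qed.

(** Since Re (r^2) >= 0, the imaginary part of r is at most its real part in
    absolute value, and sqrt 2 <= 3/2. *)
Lemma sqrt_right_half_plane (lambda : C) : 0 <= Re lambda -> lambda != 0 ->
  exists r : C, [/\ r ^+ 2 = lambda, 0 < Re r & cabs r <= 3 / 2 * Re r].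
Proof.
move=> l0 ln0.
have [r [r2 r0]] : exists r : C, r ^+ 2 = lambda /\ 0 <= Re r.
  have [h|h] := leP 0 (Re (sqrtc lambda)).
    by exists (sqrtc lambda); rewrite sqr_sqrtc.
  exists (- sqrtc lambda); rewrite sqrrN sqr_sqrtc; split => //.
  by case: (sqrtc lambda) h => u v /=; rewrite oppr_ge0 => /ltW.
have ri : Im r ^+ 2 <= Re r ^+ 2.
  by move: l0; rewrite -r2 expr2 ReM; lra.
have r1 : Re r != 0.
  apply: contra ln0 => /eqP h; rewrite -r2 sqrf_eq0; apply/eqP.
  have : Im r ^+ 2 = 0 by apply/eqP; rewrite eq_le sqr_ge0 andbT (le_trans ri)// h expr0n.
  by case: r h {r2 r0 ri} => u v /= -> /eqP; rewrite sqrf_eq0 => /eqP ->.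
have {}r0 : 0 < Re r by rewrite lt_neqAle eq_sym r1.
exists r; split => //.
rewrite -(@ler_pXn2r _ 2)// ?nnegrE ?cabs_ge0//; last by rewrite mulr_ge0// ltW.
by rewrite cabs_sqr exprMn; have := sqr_ge0 (Re r); lra.
Qed.

End ComplexModulus.

(** * Modes of the perturbed quartic equation *)

Section Quartic.
Variable F : realType.
Local Notation C := F[i].
Local Notation Re := complex.Re.
Local Notation Im := complex.Im.
Variables (a b : F).
Hypothesis b0 : 0 < b.
Hypothesis ba : b < a.

(** The four roots of (X^2 - a^2)(X^2 - b^2): the unstable ones have even
    index, the stable ones odd index. *)
Definition eta (i : 'I_4) : F := [:: a; - a; b; - b]`_i.
(** The absolute value of the roots that differ from eta i and - eta i. *)
Definition other (i : 'I_4) : F := [:: b; b; a; a]`_i.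

Lemma eta_sqr i : eta i ^+ 2 + other i ^+ 2 = a ^+ 2 + b ^+ 2 /\
  eta i ^+ 2 * other i ^+ 2 = a ^+ 2 * b ^+ 2.
Proof. by case: i => -[|[|[|[|//]]]] i4; rewrite /eta /other/=; split; ring. Qed.

Lemma eta_abs i : b <= `|eta i| <= a.
Proof.
have h0 := b0; have h1 := ba.
by case: i => -[|[|[|[|//]]]] i4; rewrite /eta/= ?normrN ger0_norm ?lexx ?andbT/=; lra.
Qed.

Lemma eta_sign i : (0 < eta i) = ~~ odd i /\ (eta i < 0) = odd i.
Proof.
have h0 := b0; have h1 := ba.
by case: i => -[|[|[|[|//]]]] i4; rewrite /eta/=; split; apply/idP => //; lra.
Qed.

Lemma eta_sep i j : i != j -> Num.min (a - b) (2 * b) <= `|eta i - eta j|.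
Proof.
have h0 := b0; have h1 := ba.
case: i => -[|[|[|[|//]]]] i4; case: j => -[|[|[|[|//]]]] j4; rewrite -val_eqE /eta//= => _;
  rewrite ge_min; apply/orP;
  solve [by left; rewrite ler_normr; apply/orP; left; lra
       | by left; rewrite ler_normr; apply/orP; right; lra
       | by right; rewrite ler_normr; apply/orP; left; lra
       | by right; rewrite ler_normr; apply/orP; right; lra].
Qed.

(** Left eigenvectors of the companion matrix of (X^2 - a^2)(X^2 - b^2): the
    coefficients of (X + eta)(X^2 - other^2), the quotient of that
    polynomial by X - eta. *)
Definition left_coef (i l : 'I_4) : F :=
  [:: - (eta i * other i ^+ 2); - other i ^+ 2; eta i; 1]`_l.

(** Right eigenvectors, normalized by the derivative of the quartic at eta
    so that the two families are dual. *)
Definition right_coef (l j : 'I_4) : F :=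
  eta j ^+ l / (2 * eta j * (eta j ^+ 2 - other j ^+ 2)).

Lemma left_right_coef i j : \sum_l left_coef i l * right_coef l j = (i == j)%:R.
Proof.
have h0 := b0; have h1 := ba.
have a0 : a != 0 by apply: lt0r_neq0; lra.
have b00 : b != 0 by apply: lt0r_neq0; lra.
have ab0 : a - b != 0 by apply: lt0r_neq0; lra.
have abp : a + b != 0 by apply: lt0r_neq0; lra.
have ab2 : a ^+ 2 - b ^+ 2 != 0 by rewrite subr_sqr mulf_neq0.
have ba2 : b ^+ 2 - a ^+ 2 != 0 by rewrite -opprB oppr_eq0.
rewrite !big_ord_recl big_ord0 /left_coef /right_coef /= /bump /= addr0.
case: i => -[|[|[|[|//]]]] i4; case: j => -[|[|[|[|//]]]] j4; rewrite -val_eqE /eta /other/=.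
all: field.
all: rewrite ?oppr_eq0 ?a0 ?b00 ?sqrrN ?ab2 ?ba2//=.
Qed.

Variables (h mu : F) (lambda r : C).
Hypothesis h0 : 0 < h.
Hypothesis ab_sum : a ^+ 2 + b ^+ 2 = h * mu.
Hypothesis ab_prod : a ^+ 2 * b ^+ 2 = h.
Hypothesis r2 : r ^+ 2 = lambda.
Hypothesis r0 : r != 0.

(** What remains of the coefficients of the equation once those of (X^2 -
    r^2 a^2)(X^2 - r^2 b^2) are removed. *)
Definition perturbation (e : nat -> F) (l : 'I_4) : C :=
  [:: h%:C * (lambda * (e 0%N)%:C); h%:C * ((e 1%N)%:C + lambda * (e 2)%:C);
      h%:C * (e 3)%:C; (2 * e 4)%:C]`_l.

(** Laid out as in [Atilde], with the values at one point of the five real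
    functions of x passed as e. *)
Definition quartic (e : nat -> F) : seq C :=
  [:: h%:C * (lambda * (e 0%N)%:C + lambda ^+ 2);
      h%:C * ((e 1%N)%:C + lambda * (e 2)%:C);
      h%:C * ((e 3)%:C - lambda * mu%:C); (2 * e 4)%:C; 1].

(** The powers of r rescale the derivatives of the unknown so that all modes
    have the same size. *)
Definition to_modes : 'M[C]_4 := \matrix_(i, l) (r ^+ (3 - l) * (left_coef i l)%:C).
Definition of_modes : 'M[C]_4 := \matrix_(l, j) (r ^- (3 - l) * (right_coef l j)%:C).

Lemma to_of_modes : to_modes *m of_modes = 1%:M.
Proof.
apply/matrixP => i j; rewrite !mxE.
have -> : (i == j)%:R = ((i == j)%:R : F)%:C by rewrite rmorph_nat.
rewrite -left_right_coef rmorph_sum; apply: eq_bigr => l _.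
by rewrite !mxE mulrACA mulfV ?mul1r ?rmorphM// expf_neq0.
Qed.

Lemma to_modes_unit : to_modes \in unitmx.
Proof. by have [] := mulmx1_unit to_of_modes. Qed.

Lemma of_to_modes : of_modes *m to_modes = 1%:M.
Proof. exact: mulmx1C to_of_modes. Qed.

(** The linear form pi by which the perturbation feeds every mode. *)
Definition coupling e (j : 'I_4) : C := \sum_l perturbation e l * of_modes l j.

Definition mode_matrix e : 'M[C]_4 :=
  \matrix_(i, j) ((r * (eta i)%:C) *+ (i == j) - coupling e j).

(** The perturbation only enters the last row of the companion matrix, and
    the last entry of each left eigenvector is 1; hence every mode receives
    the same term. *)
Lemma companion_modes e :
  to_modes *m companionmx (quartic e) = mode_matrix e *m to_modes.
Proof.
pose D : 'M[C]_4 := diag_mx (\row_i (r * (eta i)%:C)).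
pose Q : 'M[C]_4 := \matrix_(i, l) perturbation e l.
have -> : mode_matrix e = D - Q *m of_modes.
  apply/matrixP => i j; rewrite !mxE; congr (_ - _).
  by apply: eq_bigr => l _; rewrite [Q _ _]mxE.
rewrite mulmxBl -mulmxA of_to_modes mulmx1; apply/matrixP => i l.
rewrite mul_diag_mx !mxE !big_ord_recl big_ord0 !mxE/=.
have [e1 e2] := eta_sqr i.
have {}e1 : (eta i)%:C ^+ 2 + (other i)%:C ^+ 2 = h%:C * mu%:C :> C.
  by rewrite -!rmorphXn -rmorphD -rmorphM /= e1 ab_sum.
have {}e2 : (eta i)%:C ^+ 2 * (other i)%:C ^+ 2 = h%:C :> C.
  by rewrite -!rmorphXn -rmorphM /= e2 ab_prod.
rewrite /left_coef /perturbation /bump /=.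
case: l => -[|[|[|[|//]]]] l4 /=; rewrite ?rmorphN ?rmorphM ?rmorphXn ?rmorph1 -?r2/=.
- rewrite -e2; ring.
- ring.
- have -> : h%:C * ((e 3)%:C - r ^+ 2 * mu%:C) =
      h%:C * (e 3)%:C - r ^+ 2 * ((eta i)%:C ^+ 2 + (other i)%:C ^+ 2).
    rewrite e1; ring.
  ring.
- ring.
Qed.

(** The coefficient of order l is O(|r|^(3 - l)), one power of |r| less than
    the corresponding coefficient of the unperturbed equation. *)
Lemma perturbation_bound e Kc l : (forall n, `|e n| <= Kc) -> 1 <= cabs r ->
  cabs (perturbation e l) <= (2 * h + 2) * Kc * cabs r ^+ (3 - l).
Proof.
move=> eK r1; set rho := cabs r; have hp := h0.
have lE : cabs lambda = rho ^+ 2 by rewrite -r2 cabsX.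
have K0 : 0 <= Kc by exact: le_trans (normr_ge0 _) (eK 0%N).
have rho2 : 1 <= rho ^+ 2 by rewrite exprn_ege1.
have rho3 : rho ^+ 2 <= rho ^+ 3 by rewrite [leRHS]exprS ler_peMl// sqr_ge0.
have hE : cabs h%:C = h by rewrite cabsR ger0_norm// ltW.
have hK : 0 <= h * Kc by rewrite mulr_ge0// ltW.
case: l => -[|[|[|[|//]]]] l4 /=; rewrite /perturbation/= ?cabsM ?hE ?cabsM ?cabsR ?lE.
- apply: (@le_trans _ _ (h * (rho ^+ 3 * Kc))).
    by rewrite ler_wpM2l ?(ltW hp)// ler_pM ?sqr_ge0.
  have : 0 <= rho ^+ 3 by rewrite exprn_ge0 ?cabs_ge0.
  rewrite subn0; nra.
- apply: (@le_trans _ _ (h * (Kc + rho ^+ 2 * Kc))).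
    rewrite ler_wpM2l ?(ltW hp)//; apply: le_trans (cabsD _ _) _.
    by rewrite cabsM !cabsR lE lerD// ler_wpM2l ?sqr_ge0.
  rewrite (_ : (3 - 1)%N = 2)//; nra.
- apply: (@le_trans _ _ (h * Kc)); first by rewrite ler_wpM2l ?(ltW hp).
  rewrite (_ : (3 - 2)%N = 1%N)// expr1; nra.
- apply: (@le_trans _ _ (2 * Kc)); first by rewrite normrM ger0_norm// ler_wpM2l.
  rewrite (_ : (3 - 3)%N = 0%N)// expr0; nra.
Qed.

Definition right_size : F := \sum_j \sum_l `|right_coef l j|.

(** The negative powers of r in [of_modes] compensate the powers of |r| in
    [perturbation_bound], which makes the bound independent of lambda. *)
Lemma coupling_bound e Kc j : (forall n, `|e n| <= Kc) -> 1 <= cabs r ->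
  cabs (coupling e j) <= (2 * h + 2) * Kc * right_size.
Proof.
move=> eK r1; have hp := h0.
have K0 : 0 <= Kc by exact: le_trans (normr_ge0 _) (eK 0%N).
have K1 : 0 <= (2 * h + 2) * Kc by rewrite mulr_ge0//; lra.
apply: le_trans (cabs_sum _ _) _.
apply: (@le_trans _ _ ((2 * h + 2) * Kc * \sum_l `|right_coef l j|)).
  rewrite big_distrr; apply: ler_sum => l _; rewrite mxE !cabsM cabsR mulrA.
  rewrite ler_wpM2r// cabsV cabsX ler_pdivrMr; last first.
    by rewrite exprn_gt0// (lt_le_trans ltr01).
  exact: perturbation_bound.
rewrite ler_wpM2l// /right_size [leRHS](bigD1 j)//= lerDl.
by apply: sumr_ge0 => i _; exact: sumr_ge0.
Qed.

Lemma sum4_sqr_le (n : 'I_4 -> F) : (\sum_i n i) ^+ 2 <= 4 * \sum_i n i ^+ 2.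
Proof.
rewrite !big_ord_recl !big_ord0.
set n0 := n _; set n1 := n _; set n2 := n _; set n3 := n _.
have := sqr_ge0 (n0 - n1); have := sqr_ge0 (n0 - n2); have := sqr_ge0 (n0 - n3).
have := sqr_ge0 (n1 - n2); have := sqr_ge0 (n1 - n3); have := sqr_ge0 (n2 - n3).
lra.
Qed.

(** The diagonal part contributes at least b Re r |z|^2, as al, be >= 1. The
    coupling contributes at most 2 K (sum |z_i|)^2 <= 8 K |z|^2, as al, be
    <= 2. *)
Lemma mode_dichotomy (e : F -> nat -> F) (K : F) :
  (forall x j, cabs (coupling (e x) j) <= K) -> 8 * K + 1 <= b * Re r ->
  dichotomy (real_system (fun x => mode_matrix (e x))) (fun p => ~~ odd p.1) 1.
Proof.
move=> cK Kr al be x y /andP[al1 al2] /andP[be1 be2].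
have b0' := b0; have ba' := ba.
have K0 : 0 <= K by exact: le_trans (cabs_ge0 _) (cK 0 ord0).
have Rr : 0 < Re r by rewrite -(pmulr_rgt0 _ b0); lra.
pose z := cplxvec y; pose n i := cabs (z i 0).
pose w (i : 'I_4) := if ~~ odd i then al else - be.
pose pi := \sum_j coupling (e x) j * z j 0.
have yE : y = realvec z by rewrite cplxvecK.
have BzE i : (mode_matrix (e x) *m z) i 0 = r * (eta i)%:C * z i 0 - pi.
  rewrite mxE /pi; under eq_bigr do rewrite mxE mulrBl.
  rewrite sumrB; congr (_ - _).
  rewrite (bigD1 i)//= eqxx mulr1n big1 ?addr0// => j ji.
  by rewrite eq_sym (negPf ji) mulr0n mul0r.
have piK : cabs pi <= K * \sum_j n j.
  apply: le_trans (cabs_sum _ _) _; rewrite big_distrr; apply: ler_sum => j _.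
  by rewrite cabsM ler_wpM2r// cabs_ge0.
have -> : 1 * \sum_p y p ^+ 2 = \sum_i n i ^+ 2.
  rewrite mul1r yE sum_pair_bool; apply: eq_bigr => i _.
  by rewrite /n cabs_sqr.
have -> : \sum_p cone_weight (fun p : 'I_4 * bool => ~~ odd p.1) al be p *
      (y p * \sum_q real_system (fun x => mode_matrix (e x)) p q x * y q) =
    \sum_i w i * (Re (z i 0) * Re ((mode_matrix (e x) *m z) i 0) +
                  Im (z i 0) * Im ((mode_matrix (e x) *m z) i 0)).
  rewrite sum_pair_bool; apply: eq_bigr => i _.
  rewrite mulrDr /cone_weight /w/= yE /real_system -!realvec_mulmx.
  by rewrite /realvec/=.
have each i : b * Re r * n i ^+ 2 - 2 * (n i * cabs pi) <=
    w i * (Re (z i 0) * Re ((mode_matrix (e x) *m z) i 0) +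
           Im (z i 0) * Im ((mode_matrix (e x) *m z) i 0)).
  rewrite BzE.
  rewrite re_dot_mode -/(n i).
  have d1 := re_dot_le (z i 0) pi; have d2 := re_dot_le (z i 0) (- pi).
  rewrite cabsN re_dotN in d2.
  have n0 : 0 <= n i * cabs pi by rewrite mulr_ge0 ?cabs_ge0.
  have N0 : 0 <= Re r * n i ^+ 2 by rewrite mulr_ge0 ?sqr_ge0// ltW.
  move: d1 d2; rewrite -/(n i); set dd := _ + _ => d1 d2.
  have [s1 s2] := eta_sign i; have /andP[ab1 _] := eta_abs i; rewrite /w.
  case: ifPn => oi.
    rewrite gtr0_norm ?s1// in ab1.
    have : b * (Re r * n i ^+ 2) <= al * (eta i * (Re r * n i ^+ 2)).
      rewrite [leRHS]mulrA ler_wpM2r//; apply: (le_trans ab1); rewrite ler_peMl//; lra.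
    have : al * dd <= 2 * (n i * cabs pi).
      apply: (@le_trans _ _ (al * (n i * cabs pi))); rewrite ?ler_wpM2l ?ler_wpM2r//; lra.
    lra.
  rewrite ltr0_norm ?s2 ?(negbNE oi)// in ab1.
  have : b * (Re r * n i ^+ 2) <= be * (- eta i * (Re r * n i ^+ 2)).
    rewrite [leRHS]mulrA ler_wpM2r//; apply: (le_trans ab1); rewrite ler_peMl//; lra.
  have : be * - dd <= 2 * (n i * cabs pi).
    apply: (@le_trans _ _ (be * (n i * cabs pi))); rewrite ?ler_wpM2l ?ler_wpM2r//; lra.
  lra.
apply: le_trans (ler_sum _ (fun i _ => each i)).
rewrite sumrB -!big_distrr -big_distrl/=.
have := sum4_sqr_le n.
have S0 : 0 <= \sum_i n i by apply: sumr_ge0 => i _; exact: cabs_ge0.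
have N0 : 0 <= \sum_i n i ^+ 2 by apply: sumr_ge0 => i _; exact: sqr_ge0.
move: piK S0 N0; set S := \sum_i n i; set N := \sum_i n i ^+ 2 => piK S0 N0 SN.
have h1 : S * cabs pi <= K * (4 * N).
  by apply: (le_trans (ler_wpM2l S0 piK)); rewrite mulrCA -expr2 ler_wpM2l.
have h2 : (8 * K + 1) * N <= b * Re r * N by rewrite ler_wpM2r.
lra.
Qed.

Lemma ccvg_perturbation (G : set_system F) (FG : Filter G)
    (e : F -> nat -> F) (u : nat -> F) l :
  (forall n, e x n @[x --> G] --> u n) ->
  ccvg G (fun x => perturbation (e x) l) (perturbation u l).
Proof.
move=> eu; have eC n : ccvg G (fun x => (e x n)%:C) (u n)%:C by exact: ccvgR.
have cM (d : C) g v : ccvg G g v -> ccvg G (fun x => d * g x) (d * v).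
  by apply: ccvgM; exact: ccvg_cst.
case: l => -[|[|[|[|//]]]] l4.
- exact: (cM _ _ _ (cM _ _ _ (eC 0%N))).
- exact: (cM _ _ _ (ccvgD _ (eC 1%N) (cM _ _ _ (eC 2)))).
- exact: (cM _ _ _ (eC 3)).
- by apply: (@ccvgR _ G FG (fun x => 2 * e x 4)); apply: cvgMr; exact: eu.
Qed.

Lemma ccvg_mode_matrix (G : set_system F) (FG : Filter G)
    (e : F -> nat -> F) (u : nat -> F) i j :
  (forall n, e x n @[x --> G] --> u n) ->
  ccvg G (fun x => mode_matrix (e x) i j) (mode_matrix u i j).
Proof.
move=> eu; rewrite mxE (_ : (fun x => _) =
  fun x => (r * (eta i)%:C) *+ (i == j) + - coupling (e x) j); last first.
  by apply/funext => x; rewrite mxE.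
apply: ccvgD; first exact: ccvg_cst.
apply: ccvgN; apply: ccvg_sum => l.
by apply: ccvgM; [exact: ccvg_perturbation|exact: ccvg_cst].
Qed.

Lemma mode_continuous (e : F -> nat -> F) p q : (forall n, continuous (e^~ n)) ->
  continuous (real_system (fun x => mode_matrix (e x)) p q).
Proof.
move=> ce x; have [h1 h2] := @ccvg_mode_matrix (nbhs x) _ e (e x) p.1 q.1 (fun n => ce n x).
rewrite /continuous_at /real_system /realmx; case: (p.2 == q.2); first exact: h1.
by case: (p.2); [exact: h2|exact: cvgN].
Qed.

Lemma mode_bounded (e : F -> nat -> F) (K : F) p q x :
  (forall x j, cabs (coupling (e x) j) <= K) ->
  `|real_system (fun x => mode_matrix (e x)) p q x| <= cabs r * a + K.
Proof.
move=> cK.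
have : cabs (mode_matrix (e x) p.1 q.1) <= cabs r * a + K.
  rewrite mxE; apply: le_trans (cabsD _ _) _; rewrite cabsN lerD//.
  have a0 : 0 <= a by have := b0; have := ba; lra.
  case: eqP => _; last by rewrite cabs0 mulr_ge0 ?cabs_ge0.
  by rewrite mulr1n cabsM cabsR ler_wpM2l ?cabs_ge0//; have /andP[] := eta_abs p.1.
apply: le_trans; rewrite /real_system /realmx.
by case: ifP => _; [|case: ifP => _]; rewrite ?normrN ?Re_le_cabs ?Im_le_cabs.
Qed.

Lemma ccvg_quartic (G : set_system F) (FG : Filter G)
    (e : F -> nat -> F) (u : nat -> F) (l : 'I_4) :
  (forall n, e x n @[x --> G] --> u n) ->
  ccvg G (fun x => (quartic (e x))`_l) (quartic u)`_l.
Proof.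
move=> eu; have eC n : ccvg G (fun x => (e x n)%:C) (u n)%:C by exact: ccvgR.
have cM (d : C) g v : ccvg G g v -> ccvg G (fun x => d * g x) (d * v).
  by apply: ccvgM; exact: ccvg_cst.
have cD (d : C) g v : ccvg G g v -> ccvg G (fun x => g x + d) (v + d).
  by move=> gv; apply: ccvgD => //; exact: ccvg_cst.
case: l => -[|[|[|[|//]]]] l4.
- exact: (cM _ _ _ (cD _ _ _ (cM _ _ _ (eC 0%N)))).
- exact: (cM _ _ _ (ccvgD _ (eC 1%N) (cM _ _ _ (eC 2)))).
- exact: (cM _ _ _ (cD _ _ _ (eC 3))).
- by apply: (@ccvgR _ G FG (fun x => 2 * e x 4)); apply: cvgMr; exact: eu.
Qed.

Lemma quartic_companion_cvg (G : set_system F) (FG : Filter G)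
    (e : F -> nat -> F) (u : nat -> F) :
  (forall n, e x n @[x --> G] --> u n) ->
  mxcvg G (fun x => companionmx (quartic (e x)) : 'M[C]_4) (companionmx (quartic u)).
Proof.
move=> eu i j.
suff : ccvg G (fun x => (companionmx (quartic (e x)) : 'M[C]_4) i j)
  ((companionmx (quartic u) : 'M[C]_4) i j) by [].
rewrite mxE (_ : (fun x => _) = fun x =>
    if (i == 3 :> nat) then - (quartic (e x))`_j else (i.+1 == j :> nat)%:R); last first.
  by apply/funext => x; rewrite mxE.
rewrite /=; case: ifP => _; last exact: ccvg_cst.
by apply: ccvgN; exact: ccvg_quartic.
Qed.

(** r eta is a root of the unperturbed polynomial. *)
Lemma quartic_at_mode e (i : 'I_4) :
  (Poly (quartic e)).[r * (eta i)%:C] =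
  \sum_l perturbation e l * (r * (eta i)%:C) ^+ l.
Proof.
rewrite horner_Poly !big_ord_recl big_ord0 /quartic /perturbation /bump /=.
have [e1 e2] := eta_sqr i.
have {}e1 : (eta i)%:C ^+ 2 + (other i)%:C ^+ 2 = h%:C * mu%:C :> C.
  by rewrite -!rmorphXn -rmorphD -rmorphM /= e1 ab_sum.
have {}e2 : (eta i)%:C ^+ 2 * (other i)%:C ^+ 2 = h%:C :> C.
  by rewrite -!rmorphXn -rmorphM /= e2 ab_prod.
rewrite -r2 !(mulrBr h%:C) !(mulrDr h%:C).
rewrite (_ : h%:C * (r ^+ 2 * mu%:C) =
  r ^+ 2 * ((eta i)%:C ^+ 2 + (other i)%:C ^+ 2)); last first.
  rewrite e1; ring.
rewrite (_ : h%:C * (r ^+ 2) ^+ 2 =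
  (eta i)%:C ^+ 2 * (other i)%:C ^+ 2 * (r ^+ 2) ^+ 2); last first.
  by rewrite e2.
ring.
Qed.

Definition eta_size : F := \sum_i \sum_(l < 4) `|eta i| ^+ l.

Lemma quartic_at_mode_bound e Kc i : (forall n, `|e n| <= Kc) -> 1 <= cabs r ->
  cabs (Poly (quartic e)).[r * (eta i)%:C] <=
    (2 * h + 2) * Kc * eta_size * cabs r ^+ 3.
Proof.
move=> eK r1; have hp := h0.
have K0 : 0 <= Kc by exact: le_trans (normr_ge0 _) (eK 0%N).
have K1 : 0 <= (2 * h + 2) * Kc by rewrite mulr_ge0//; lra.
rewrite quartic_at_mode; apply: le_trans (cabs_sum _ _) _.
apply: (@le_trans _ _ ((2 * h + 2) * Kc * (\sum_(l < 4) `|eta i| ^+ l) * cabs r ^+ 3)).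
  rewrite big_distrr big_distrl/=; apply: ler_sum => l _.
  rewrite cabsM cabsX cabsM cabsR exprMn.
  have -> : cabs r ^+ 3 = cabs r ^+ (3 - l) * cabs r ^+ l.
    by rewrite -exprD subnK// -ltnS.
  rewrite mulrACA [X in _ <= X](_ : _ =
    (2 * h + 2) * Kc * cabs r ^+ (3 - l) * (cabs r ^+ l * `|eta i| ^+ l)); last by ring.
  rewrite ler_wpM2r ?perturbation_bound//.
  by rewrite mulr_ge0// exprn_ge0// cabs_ge0.
rewrite ler_wpM2r ?exprn_ge0 ?cabs_ge0// ler_wpM2l// /eta_size [leRHS](bigD1 i)//= lerDl.
by apply: sumr_ge0 => j _; apply: sumr_ge0 => l _; rewrite exprn_ge0.
Qed.

(** The value at x is the product of the distances from x to the roots. *)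
Lemma exists_near_root (rs : seq C) (x : C) (d : F) : 0 <= d ->
  cabs (\prod_(z <- rs) ('X - z%:P)).[x] < d ^+ size rs ->
  exists2 z, z \in rs & cabs (x - z) < d.
Proof.
move=> d0; elim: rs => [|z rs IH].
  by rewrite big_nil hornerC expr0 (cabsR 1) normr1 ltxx.
rewrite big_cons hornerM hornerXsubC cabsM exprS => pd.
have [zd|zd] := ltP (cabs (x - z)) d; first by exists z; rewrite ?mem_head.
have [|w wrs wd] := IH; last by exists w; rewrite // inE wrs orbT.
rewrite ltNge; apply/negP => pd'; move: pd; rewrite ltNge => /negP; apply.
by rewrite ler_pM// exprn_ge0.
Qed.

(** Small enough for the discs of radius gap around the roots eta to be
    disjoint and away from the imaginary axis. *)
Definition gap : F := Num.min (a - b) b / 3.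

Lemma gap_gt0 : 0 < gap.
Proof. by rewrite divr_gt0// lt_min subr_gt0 ba b0. Qed.

(** Every disc of radius gap |r| around r eta contains an eigenvalue; the
    discs are disjoint, so they account for the four eigenvalues, and each
    eigenvalue has a real part of the sign of eta. *)
Lemma quartic_two_two_split e Kc : (forall n, `|e n| <= Kc) -> 1 <= cabs r ->
  0 < Re r -> cabs r <= 3 / 2 * Re r ->
  (2 * h + 2) * Kc * eta_size < gap ^+ 4 * cabs r ->
  two_two_split (companionmx (quartic e)).
Proof.
move=> eK r1 Rr rR big; set rho := cabs r in r1 rR big.
have rho0 : 0 < rho by rewrite (lt_le_trans ltr01).
have g0 := gap_gt0.
have pE : Poly (quartic e) = quartic e :> seq C.
  by apply: (PolyK (c := 0)); rewrite /= oner_neq0.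
have char : char_poly (companionmx (quartic e)) = Poly (quartic e).
  have : forall s : seq C, s = Poly (quartic e) -> char_poly (companionmx s) = Poly (quartic e).
    move=> s ->; apply: companionmxK.
    by rewrite monicE lead_coefE pE.
  by apply; rewrite pE.
have [rs rsE] := closed_field_poly_normal (Poly (quartic e)).
have lead1 : lead_coef (Poly (quartic e)) = 1 by rewrite lead_coefE pE.
rewrite lead1 scale1r in rsE.
have szrs : size rs = 4%N.
  by apply: succn_inj; rewrite -(size_prod_XsubC rs id) -rsE pE.
pose x i : C := r * (eta i)%:C.
have /choice[Z ZP] : forall i, exists z, z \in rs /\ cabs (x i - z) < gap * rho.
  move=> i; have [||z zrs zx] := @exists_near_root rs (x i) (gap * rho).
  - by rewrite mulr_ge0// ltW.
  - rewrite szrs -rsE; apply: le_lt_trans (quartic_at_mode_bound i eK r1) _.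
    by rewrite -/rho exprMn [rho ^+ 4]exprS [ltRHS]mulrA ltr_pM2r// exprn_gt0.
  - by exists z.
(* A radius of at most (b / 3) |r| <= (b / 2) Re r keeps the disc on its
   side of the imaginary axis. *)
have gap_b : gap <= b / 3 by rewrite /gap ler_pM2r// ge_min lexx orbT.
have gap_ab : gap <= (a - b) / 3 by rewrite /gap ler_pM2r// ge_min lexx.
have Zinj : injective Z.
  move=> i j Zij; apply/eqP/negPn/negP => ij.
  have hi := (ZP i).2; have hj := (ZP j).2.
  have sep : Num.min (a - b) (2 * b) * rho <= cabs (x i - x j).
    rewrite /x -mulrBr -rmorphB cabsM cabsR mulrC ler_wpM2l ?cabs_ge0//.
    exact: eta_sep.
  have : cabs (x i - x j) < gap * rho + gap * rho.
    have -> : x i - x j = (x i - Z i) + - (x j - Z j) by rewrite Zij; ring.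
    by apply: le_lt_trans (cabsD _ _) _; rewrite cabsN ltrD.
  rewrite ltNge; apply/negP/negPn; apply: le_trans sep.
  rewrite -mulrDl ler_wpM2r ?(ltW rho0)// le_min.
  have h1 := b0; have h2 := ba; apply/andP; split; lra.
have Zsign i : (0 < Re (Z i)) = ~~ odd i /\ (Re (Z i) < 0) = odd i.
  have hi := (ZP i).2.
  have dR : `|Re (x i) - Re (Z i)| < b * Re r.
    apply: (@le_lt_trans _ _ (cabs (x i - Z i))).
      apply: le_trans (Re_le_cabs _); rewrite le_eqVlt; apply/orP; left; apply/eqP.
      by case: (x i) (Z i) => ? ? [].
    apply: (lt_le_trans hi); apply: (@le_trans _ _ (b / 3 * (3 / 2 * Re r))).
      by rewrite ler_pM// ltW.
    have : 0 < b * Re r by rewrite mulr_gt0.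
    lra.
  have xE : Re (x i) = eta i * Re r by rewrite /x ReM/= mulr0 subr0 mulrC.
  have [s1 s2] := eta_sign i; have /andP[ab1 _] := eta_abs i.
  move: dR; rewrite xE ltr_norml => /andP[d1 d2].
  have [oi|oi] := boolP (odd i).
    rewrite ltr0_norm ?s2// in ab1.
    have : b * Re r <= - eta i * Re r by rewrite ler_wpM2r// ltW.
    move=> h1; split; last by lra.
    by apply/negbTE; rewrite -leNgt; lra.
  rewrite gtr0_norm ?s1// in ab1.
  have : b * Re r <= eta i * Re r by rewrite ler_wpM2r// ltW.
  move=> h1; split; first by lra.
  by apply/negbTE; rewrite -leNgt; lra.
have perm : perm_eq rs [seq Z i | i : 'I_4].
  have uz : uniq [seq Z i | i : 'I_4] by rewrite map_inj_uniq ?enum_uniq.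
  have sub : {subset [seq Z i | i : 'I_4] <= rs}.
    by move=> z /mapP[i _ ->]; exact: (ZP i).1.
  have sz : (size rs <= size [seq Z i | i : 'I_4])%N by rewrite size_map size_enum_ord szrs.
  have [sE mE] := uniq_min_size uz sub sz.
  rewrite perm_sym; apply: uniq_perm => //.
  by rewrite -(eq_uniq sE mE).
exists rs; split; first by rewrite char.
  rewrite (permP perm) count_map; under eq_count do rewrite /= (Zsign _).1.
  by rewrite enum_ordSl enum_ordSl enum_ordSl enum_ordSl enum_ord0.
rewrite (permP perm) count_map; under eq_count do rewrite /= (Zsign _).2.
by rewrite enum_ordSl enum_ordSl enum_ordSl enum_ordSl enum_ord0.
Qed.

End Quartic.

(** * Decay of epsilon *)

Section Epsilon.
Variables (F : realType) (gamma mu k s : F) (R U : F -> F).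

(** Beyond index 4 [nth] gives 0, so that bounds and limits can be stated
    for every index. *)
Definition coef_values (x : F) (n : nat) : F :=
  [:: E_rho mu s R U x; E_drho gamma mu k s R U x; E_drho_lambda mu s R U x;
      E_d2rho gamma mu k s R U x; E_d3rho mu k s R x]`_n.

Lemma supabs_bound (D : set F) (f : F -> F) K : D !=set0 ->
  (forall x, `|f x| <= K) -> 0 <= supabs D f <= K.
Proof.
move=> [x Dx] fK.
have ubK : ubound [set `|f y| | y in D] K by move=> _ [y _ <-].
have ne : [set `|f y| | y in D] !=set0 by exists `|f x|, x.
apply/andP; split; last exact: ge_sup.
apply: le_trans (normr_ge0 (f x)) _.
by apply: ub_le_sup; [exists K|exists x].
Qed.

Variable K : F.
Hypothesis eK : forall x n, `|coef_values x n| <= K.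
Variable D : set F.
Hypothesis D0 : D !=set0.

(** For |lambda| >= 1 the powers -1 and -3/2 of |lambda| are at most the
    power -1/2. *)
Lemma m_bound lambda l : 1 <= cabs lambda ->
  0 <= m_ gamma mu k s R U D lambda l <=
    (4 / k ^+ 2 + 2) * K * cabs lambda `^ (- (1 / 2)).
Proof.
move=> l1.
have b0 : 0 <= supabs D (E_rho mu s R U) <= K.
  by apply: supabs_bound => // x; exact: (eK x 0%N).
have b1 : 0 <= supabs D (E_drho gamma mu k s R U) <= K.
  by apply: supabs_bound => // x; exact: (eK x 1%N).
have b2 : 0 <= supabs D (E_drho_lambda mu s R U) <= K.
  by apply: supabs_bound => // x; exact: (eK x 2%N).
have b3 : 0 <= supabs D (E_d2rho gamma mu k s R U) <= K.
  by apply: supabs_bound => // x; exact: (eK x 3%N).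
have b4 : 0 <= supabs D (E_d3rho mu k s R) <= K.
  by apply: supabs_bound => // x; exact: (eK x 4%N).
set L := cabs lambda in l1 *; set t := L `^ (- (1 / 2)).
have t0 : 0 <= t by exact: powR_ge0.
have t1 : 0 <= L `^ (- 1) <= t by rewrite powR_ge0/= ler_powR//; lra.
have t2 : 0 <= L `^ (- (3 / 2)) <= t by rewrite powR_ge0/= ler_powR//; lra.
have K0 : 0 <= K by case/andP: b0 => h1 h2; exact: le_trans h2.
have tp (u v : F) : 0 <= u <= t -> 0 <= v <= K -> 0 <= u * v <= K * t.
  move=> /andP[u0 ut] /andP[v0 vK]; rewrite mulr_ge0//= mulrC ler_pM//.
have tt : 0 <= t <= t by rewrite t0 lexx.
have c0 : 0 <= 2 / k ^+ 2 by rewrite divr_ge0// sqr_ge0.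
have -> : 4 / k ^+ 2 = 2 * (2 / k ^+ 2) by rewrite mulrA; congr (_ / _); ring.
move: c0; set c := 2 / k ^+ 2 => c0.
have Kt : 0 <= K * t by rewrite mulr_ge0.
have cKt : 0 <= c * (K * t) by rewrite mulr_ge0.
have sc (v d : F) : 0 <= d -> 0 <= v <= d * (K * t) -> 0 <= c * v <= c * (d * (K * t)).
  by move=> d0 /andP[v0 v1]; rewrite mulr_ge0//= ler_wpM2l.
case: l => -[|[|[|[|//]]]] l4; rewrite /m_/=.
- have := sc _ 1 ler01; rewrite mul1r => /(_ _ (tp _ _ t1 b0)) /andP[h1 h2].
  by rewrite /m1 -/L h1/=; apply: le_trans h2 _; lra.
- have /andP[h1 h2] := tp _ _ t2 b1; have /andP[h3 h4] := tp _ _ tt b2.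
  have /andP[h5 h6] : 0 <= c * (L `^ (- (3 / 2)) * supabs D (E_drho gamma mu k s R U)
      + t * supabs D (E_drho_lambda mu s R U)) <= c * (2 * (K * t)).
    by apply: sc => //; rewrite addr_ge0//=; lra.
  by rewrite /m2 -/L -/t -/c h5/=; apply: le_trans h6 _; lra.
- have := sc _ 1 ler01; rewrite mul1r => /(_ _ (tp _ _ t1 b3)) /andP[h1 h2].
  by rewrite /m3 -/L h1/=; apply: le_trans h2 _; lra.
- have /andP[h1 h2] := tp _ _ tt b4.
  by rewrite /m4 -/L -/t; apply/andP; split; [rewrite mulr_ge0|lra].
Qed.

Definition weight_size : F := \sum_j \sum_(l < 4) w_ mu k j `^ (l%:R / 2).

Lemma p_bound lambda j : 1 <= cabs lambda ->
  0 <= p_ gamma mu k s R U D lambda j <=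
    (4 / k ^+ 2 + 2) * K * weight_size * cabs lambda `^ (- (1 / 2)).
Proof.
move=> l1.
have mK l := @m_bound lambda l l1.
have m0 : 0 <= (4 / k ^+ 2 + 2) * K * cabs lambda `^ (- (1 / 2)).
  by have /andP[h1 h2] := mK ord0; exact: le_trans h2.
apply/andP; split.
  by apply: sumr_ge0 => l _; have /andP[h _] := mK l; rewrite mulr_ge0// powR_ge0.
apply: (@le_trans _ _ (\sum_(l < 4) (4 / k ^+ 2 + 2) * K * cabs lambda `^ (- (1 / 2))
    * w_ mu k j `^ (l%:R / 2))).
  by apply: ler_sum => l _; have /andP[_ h] := mK l; rewrite ler_wpM2r// powR_ge0.
rewrite -big_distrr/= [leRHS]mulrAC ler_wpM2l// /weight_size [leRHS](bigD1 j)//= lerDl.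
by apply: sumr_ge0 => i _; apply: sumr_ge0 => l _; exact: powR_ge0.
Qed.

Definition inv_size : F := \sum_(j < 4) `|q_ mu k j|^-1.

Lemma frobenius_bound lambda : 1 <= cabs lambda ->
  0 <= frobenius (Btilde gamma mu k s R U D lambda) <=
  4 * ((4 / k ^+ 2 + 2) * K * weight_size * cabs lambda `^ (- (1 / 2)) * inv_size).
Proof.
move=> l1; rewrite /frobenius sqrtr_ge0/=.
set P := _ * cabs lambda `^ _; set Q := inv_size.
have pP j : 0 <= p_ gamma mu k s R U D lambda j <= P by exact: p_bound.
have P0 : 0 <= P by have /andP[h1 h2] := pP ord0; exact: le_trans h2.
have Q0 : 0 <= Q by apply: sumr_ge0 => j _; rewrite invr_ge0.
have PQ0 : 0 <= 4 * (P * Q) by apply: mulr_ge0 => //; exact: mulr_ge0.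
rewrite -[leRHS](ger0_norm PQ0) -sqrtr_sqr ler_wsqrtr//.
apply: (@le_trans _ _ (\sum_(j < 4) \sum_(l < 4) (P * Q) ^+ 2)).
  apply: ler_sum => j _; apply: ler_sum => l _.
  have PQ1 := mulr_ge0 P0 Q0.
  rewrite mxE; apply: lerXn2r; rewrite ?nnegrE// normrM normfV.
  have /andP[h1 h2] := pP l; rewrite (ger0_norm h1) ler_pM ?invr_ge0//.
  rewrite /Q /inv_size [leRHS](bigD1 j)//= lerDl.
  by apply: sumr_ge0 => i _; rewrite invr_ge0.
rewrite !sumr_const !card_ord -mulrnA le_eqVlt; apply/orP; left; apply/eqP; ring.
Qed.

Definition epsilon_const : F :=
  16 * (alpha mu k)^-1 * ((4 / k ^+ 2 + 2) * K * weight_size * inv_size).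

Lemma epsilon_sqr_le lambda : 1 <= cabs lambda ->
  epsilon gamma mu k s R U D lambda ^+ 2 <= epsilon_const ^+ 2 / cabs lambda.
Proof.
move=> l1; have /andP[f0 f1] := frobenius_bound l1.
have L0 : 0 < cabs lambda by exact: lt_le_trans l1.
have a0 : 0 <= (alpha mu k)^-1 by rewrite invr_ge0 sqrtr_ge0.
have tt : (cabs lambda)^-1 = (cabs lambda `^ (- (1 / 2))) ^+ 2.
  rewrite expr2 -powRD ?(gt_eqF L0) ?implybT//.
  by rewrite (_ : _ + _ = -1) ?powR_inv1 ?(ltW L0)//; field.
have e0 : 0 <= epsilon gamma mu k s R U D lambda by rewrite !mulr_ge0.
have e1 : epsilon gamma mu k s R U D lambda <= epsilon_const * cabs lambda `^ (- (1 / 2)).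
  apply: (le_trans (ler_wpM2l _ f1)); first by rewrite mulr_ge0.
  by rewrite /epsilon_const le_eqVlt; apply/orP; left; apply/eqP; ring.
by rewrite tt -exprMn ler_pXn2r ?nnegrE// (le_trans e0 e1).
Qed.

End Epsilon.

(** * Large values of the parameter *)

Section Assembly.
Variables (F : realType) (gamma mu k s : F) (R U : F -> F).
Hypothesis hmu : 0 < mu.
Hypothesis hk : 0 < k.
Hypothesis hprofile : is_profile gamma mu k s R U.
Hypothesis hmuk : 2 * k ^+ 2 < mu ^+ 2.
Local Notation vals := (coef_values gamma mu k s R U).

Lemma coef_values_asymptotic n : asymptotic (fun x => vals x n).
Proof.
case: n => [|[|[|[|[|n]]]]].
- exact: tame_asymptotic (tame_E_rho hprofile 0%N).
- exact: tame_asymptotic (tame_E_drho hprofile 0%N).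
- exact: tame_asymptotic (tame_E_drho_lambda hprofile 0%N).
- exact: tame_asymptotic (tame_E_d2rho hprofile 0%N).
- exact: tame_asymptotic (tame_E_d3rho hprofile 0%N).
rewrite (_ : (fun x => _) = fun=> 0); first exact: asymptotic_cst.
by apply/funext => x; rewrite /coef_values nth_default.
Qed.

Lemma coef_values_bounded : exists K, forall x n, `|vals x n| <= K.
Proof.
have /choice[M MP] n := asymptotic_bounded (coef_values_asymptotic n).
exists (\sum_(n < 5) `|M n|) => x n.
have [n5|n5] := ltnP n 5; last first.
  by rewrite /coef_values nth_default// normr0; apply: sumr_ge0.
rewrite (bigD1 (Ordinal n5))//=; apply: (le_trans (MP n x)).
by apply: (le_trans (ler_norm _)); rewrite lerDl; apply: sumr_ge0.
Qed.

Lemma discriminant_gt0 : 0 < mu ^+ 2 / k ^+ 2 - 2.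
Proof. by rewrite subr_gt0 ltr_pdivlMr// exprn_gt0. Qed.

Lemma w_sum : w_plus mu k + w_minus mu k = 2 / k ^+ 2 * mu.
Proof. by rewrite /w_plus /w_minus; ring. Qed.

Lemma w_prod : w_plus mu k * w_minus mu k = 2 / k ^+ 2.
Proof.
have k0 : k != 0 by exact: lt0r_neq0.
rewrite /w_plus /w_minus mulrC -subr_sqr [(1 / k * _) ^+ 2]exprMn.
by rewrite sqr_sqrtr ?(ltW discriminant_gt0)//; field.
Qed.

Lemma w_lt : w_minus mu k < w_plus mu k.
Proof.
have h : 0 < 1 / k * Num.sqrt (mu ^+ 2 / k ^+ 2 - 2).
  by rewrite mulr_gt0 ?divr_gt0// sqrtr_gt0 discriminant_gt0.
by rewrite /w_plus /w_minus; lra.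
Qed.

Lemma w_minus_gt0 : 0 < w_minus mu k.
Proof.
have h : 0 < 2 / k ^+ 2 by rewrite divr_gt0// exprn_gt0.
have wp : 0 < w_plus mu k.
  have : 0 < 2 / k ^+ 2 * mu by rewrite mulr_gt0.
  by rewrite -w_sum; have := w_lt; lra.
by rewrite -(pmulr_rgt0 _ wp) w_prod.
Qed.

(** The two largeness conditions, on the dichotomy and on the localization
    of the eigenvalues, are lower bounds on |r| = |lambda|^(1/2), whence the
    square. *)
Lemma evans_nonzero_far : exists T : F, forall lambda : F[i],
  0 <= complex.Re lambda -> T <= cabs lambda ->
  evans_nonzero (Atilde gamma mu k s R U lambda).
Proof.
pose a := Num.sqrt (w_plus mu k); pose b := Num.sqrt (w_minus mu k).
pose h := 2 / k ^+ 2.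
have wm0 := w_minus_gt0; have wlt := w_lt.
have wp0 : 0 < w_plus mu k by exact: lt_trans wlt.
have b0 : 0 < b by rewrite sqrtr_gt0.
have ba : b < a by rewrite ltr_sqrt.
have h0 : 0 < h by rewrite divr_gt0// exprn_gt0.
have absum : a ^+ 2 + b ^+ 2 = h * mu by rewrite !sqr_sqrtr ?(ltW wm0) ?(ltW wp0)// w_sum.
have abprod : a ^+ 2 * b ^+ 2 = h by rewrite !sqr_sqrtr ?(ltW wm0) ?(ltW wp0)// w_prod.
have [K eK] := coef_values_bounded.
pose K1 := (2 * h + 2) * K * right_size a b.
pose K2 := (2 * h + 2) * K * eta_size a b.
have g0 : 0 < gap a b by exact: gap_gt0.
pose T := 1 + `|(8 * K1 + 1) * (3 / 2) / b| + `|K2 / gap a b ^+ 4|.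
have T1 : 1 <= T by rewrite /T -addrA lerDl addr_ge0.
exists (T ^+ 2) => lambda l0 lT.
have l1 : 0 < cabs lambda by apply: lt_le_trans lT; rewrite exprn_gt0// (lt_le_trans ltr01).
have ln0 : lambda != 0 by rewrite -cabs_eq0 gt_eqF.
have [r [r2 Rr rR]] := sqrt_right_half_plane l0 ln0.
have rT : T <= cabs r.
  rewrite -(@ler_pXn2r _ 2)// ?nnegrE ?cabs_ge0//; last exact: le_trans T1.
  by rewrite -cabsX r2.
have r1 : 1 <= cabs r by exact: le_trans rT.
have r0 : r != 0 by rewrite -cabs_eq0 gt_eqF// (lt_le_trans ltr01).
have cK x j := @coupling_bound F a b h lambda r h0 r2 (vals x) K j (eK x) r1.
have Kr : 8 * K1 + 1 <= b * complex.Re r.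
  have : (8 * K1 + 1) * (3 / 2) / b <= cabs r.
    apply: le_trans rT; rewrite /T; have := ler_norm ((8 * K1 + 1) * (3 / 2) / b).
    have := normr_ge0 (K2 / gap a b ^+ 4); lra.
  rewrite ler_pdivrMr// => h1.
  have : cabs r * b <= 3 / 2 * complex.Re r * b by rewrite ler_wpM2r// ltW.
  lra.
have big : K2 < gap a b ^+ 4 * cabs r.
  rewrite mulrC -ltr_pdivrMr ?exprn_gt0//; apply: lt_le_trans rT.
  have := ler_norm (K2 / gap a b ^+ 4); rewrite /T.
  have := normr_ge0 ((8 * K1 + 1) * (3 / 2) / b); lra.
have cvals n : continuous (vals^~ n) by have [] := coef_values_asymptotic n.
have split_of (G : set_system F) : ProperFilter G ->
    (forall n, exists l : F, vals x n @[x --> G] --> l) ->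
    split_at (Atilde gamma mu k s R U lambda) G.
  move=> FG /choice[u uP].
  have uK n : `|u n| <= K.
    apply: (cvgr_to_le (cvg_norm (uP n))); apply: nearW => x; exact: eK.
  exists (companionmx (quartic h mu lambda u)).
    exact: (quartic_companion_cvg h mu lambda _ uP).
  exact: (quartic_two_two_split b0 ba h0 absum abprod r2 uK r1 Rr rR big).
have dich := mode_dichotomy b0 ba cK Kr.
apply: (evans_nonzero_of_split
  (B := fun x => mode_matrix a b h lambda r (vals x)) (P := to_modes a b r)
  (M := cabs r * a + K1) _ _ ltr01 dich).
- by move=> p q; exact: mode_continuous.
- by move=> p q x; exact: (mode_bounded b0 ba p q x cK).
- exact: (to_modes_unit b0 ba r0).
- move=> x; exact: (companion_modes b0 ba absum abprod r2 r0).
- apply: split_of => n; have [_ [lm [lp [h1 _]]]] := coef_values_asymptotic n.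
  by exists lm.
- apply: split_of => n; have [_ [lm [lp [_ h1]]]] := coef_values_asymptotic n.
  by exists lp.
Qed.

Lemma epsilon_far : exists T : F, 1 <= T /\ forall lambda : F[i], T <= cabs lambda ->
  Num.sqrt 2 * Num.sqrt (epsilon_plus gamma mu k s R U lambda ^+ 2
                         + epsilon_minus gamma mu k s R U lambda ^+ 2) < 1.
Proof.
have [K eK] := coef_values_bounded.
pose Z := epsilon_const mu k K.
exists (4 * Z ^+ 2 + 1); split; first by rewrite lerDr mulr_ge0// sqr_ge0.
move=> lambda lT.
have Z0 : 0 <= Z ^+ 2 by exact: sqr_ge0.
have l1 : 1 <= cabs lambda by lra.
have Dp : [set x : F | 0 <= x] !=set0 by exists 0 => /=.
have Dm : [set x : F | x <= 0] !=set0 by exists 0 => /=.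
have hp := epsilon_sqr_le eK Dp l1; have hm := epsilon_sqr_le eK Dm l1.
rewrite -sqrtrM// -[ltRHS]sqrtr1 ltr_sqrt//.
have : Z ^+ 2 / cabs lambda < 4^-1.
  rewrite ltr_pdivrMr ?(lt_le_trans ltr01)//; lra.
move: hp hm; rewrite -/Z /epsilon_plus /epsilon_minus; lra.
Qed.

End Assembly.

Local Close Scope complex_scope.
Local Close Scope classical_set_scope.
Unset Implicit Arguments.
Set Strict Implicit.

Theorem lemma3p2 (F : realType) (gamma mu k s : F) (R U : F -> F)
    (hgamma : 1 <= gamma) (hmu : 0 < mu) (hk : 0 < k)
    (hprofile : is_profile gamma mu k s R U)
    (hmuk : 2 * k ^+ 2 < mu ^+ 2) :
  exists C : F, 0 < C /\
    (forall lambda : F[i], 0 <= complex.Re lambda -> C <= cabs lambda ->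
       Num.sqrt 2 * Num.sqrt (epsilon_plus gamma mu k s R U lambda ^+ 2
                              + epsilon_minus gamma mu k s R U lambda ^+ 2) < 1)
    /\
    (forall lambda : F[i], 0 <= complex.Re lambda -> C <= cabs lambda ->
       evans_nonzero (Atilde gamma mu k s R U lambda)).
Proof.
have [T1 [T1ge hT1]] := epsilon_far hprofile.
have [T2 hT2] := evans_nonzero_far hmu hk hprofile hmuk.
exists (Num.max T1 T2); split; first by rewrite lt_max (lt_le_trans ltr01 T1ge).
by split=> lambda l0; rewrite ge_max => /andP[l1 l2]; [exact: hT1|exact: hT2].
Qed.
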